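(* Let $M$ be a wide-sense stationary $L^2$ random measure on $\mathbb R^2$ whose spectral density $s$ satisfies, for some finite constant $c$, $s(u)\le c\,u_2^2$ for all $u=(u_1,u_2)$ in some neighbourhood of $(1,0)$. Then $M$ is (linearly) $0$-rigid on every convex body $A\subset\mathbb R^2$.
   Context: $\mathcal C_c^b(\mathbb R^2)$ is the space of bounded measurable compactly supported functions on $\mathbb R^2$, $\mathcal C_c^b(A^c)$ the subspace of those vanishing on $A$, and $\hat f(u)=\int e^{-i\langle u,x\rangle}f(x)\,dx$. A convex body is a compact convex set with non-empty interior. Wide-sense stationary (WSS) $L^2$ random (signed) measure $M$ on $\mathbb R^2$: a linear family of real $L^2$ random variables $I_M(f)$, $f\in\mathcal C_c^b(\mathbb R^2)$ real (extended linearly to complex $f$), such that $\mathrm{Var}(I_M(f))$ is invariant under translations of $f$ and $\mathrm{Var}(I_M(f))=(2\pi)^{-2}\int|\hat f|^2\,d\mathsf S$ for a non-negative symmetric measure $\mathsf S$ on $\mathbb R^2$, the spectral measure. The spectral density $s$ is the density of the absolutely continuous part of $\mathsf S$. $M$ is linearly $0$-rigid on $A$ if $\inf_{h\in\mathcal C_c^b(A^c)}\mathrm{Var}(I_M(1_A)-I_M(h))=0$. *)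

(* Defs.v *)
From mathcomp Require Export all_boot all_order all_algebra.
From mathcomp Require Export all_classical all_reals all_analysis.
From mathcomp Require Export complex.

Set Implicit Arguments.
Unset Strict Implicit.
Unset Printing Implicit Defensive.

Export Order.TTheory GRing.Theory Num.Theory numFieldNormedType.Exports.

Local Open Scope classical_set_scope.
Local Open Scope ring_scope.

(* R * R with its Borel sets. Its carrier is R * R itself; going through
   measurableTypeR, the structure on which lebesgue_measure is defined, keeps
   the measures below in the same measurable type as products of
   lebesgue_measure. *)
Notation borel2 R := (measurableTypeR R * measurableTypeR R)%type.

Definition lebesgue2 (R : realType) : {measure set (borel2 R) -> \bar R} :=
  (@lebesgue_measure R \x @lebesgue_measure R)%E.
Arguments lebesgue2 : clear implicits.

Definition plane_dot (R : realType) (u x : R * R) : R :=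
  u.1 * x.1 + u.2 * x.2.

Definition Ccb (R : realType) (f : R * R -> R) : Prop :=
  [/\ bounded_fun f, measurable_fun [set: borel2 R] f
    & compact (closure [set x | f x != 0])].

(* The Fourier transform of a real function, with e^{-i t} = cos t - i sin t:
   the real and imaginary parts are integrated separately. *)
Definition fourier2 (R : realType) (f : R * R -> R) (u : R * R) : R[i] :=
  Complex
    (\int[lebesgue2 R]_x (cos (plane_dot u x) * f x))
    (- \int[lebesgue2 R]_x (sin (plane_dot u x) * f x)).

(* M f plays the role of I_M(f); the values of M outside Ccb are irrelevant.
   Random variables are considered up to almost sure equality, hence the form
   of linearity. *)
Record L2_random_measure (d : measure_display) (T : measurableType d)
    (R : realType) (P : probability T R) (M : (R * R -> R) -> T -> R) : Prop := {
  random_measure_L2 : forall f, Ccb f -> M f \in Lfun P 2%:E ;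
  random_measure_linear : forall (a b : R) f g, Ccb f -> Ccb g ->
    {ae P, forall t, M (fun x => a * f x + b * g x) t = a * M f t + b * M g t}
}.

(* For complex f = f1 + i f2, I_M(f) = I_M(f1) + i I_M(f2); as S is symmetric,
   the variance formula for complex f is the sum of those for f1 and f2. *)
Record WSS_random_measure (d : measure_display) (T : measurableType d)
    (R : realType) (P : probability T R) (M : (R * R -> R) -> T -> R)
    (S : {measure set (borel2 R) -> \bar R}) : Prop := {
  WSS_L2 : L2_random_measure P M ;
  WSS_stationary : forall f (y : R * R), Ccb f ->
    'V_P[M (fun x => f (x - y))] = 'V_P[M f] ;
  WSS_symmetric : forall B : set (borel2 R), measurable B ->
    S [set u : R * R | B (- u)] = S B ;
  WSS_spectral : forall f, Ccb f ->
    'V_P[M f] = (((2 * pi) ^- 2)%:E *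
                 \int[S]_(u in [set: borel2 R])
                    (Normc.normc (fourier2 f u) ^+ 2)%:E)%E
}.

Definition mutually_singular (d : measure_display) (T : measurableType d)
    (R : realType) (m1 m2 : {measure set T -> \bar R}) : Prop :=
  exists N : set T, [/\ measurable N, m1 N = 0%E & m2 (~` N) = 0%E].

(* s is a (version of the) density of the absolutely continuous part in the
   Lebesgue decomposition of S. *)
Definition spectral_density (R : realType)
    (S : {measure set (borel2 R) -> \bar R}) (s : R * R -> R) : Prop :=
  [/\ measurable_fun [set: borel2 R] s, forall u, 0 <= s u
    & exists Ssing : {measure set (borel2 R) -> \bar R},
        mutually_singular Ssing (lebesgue2 R) /\
        forall B : set (borel2 R), measurable B ->
          S B = (\int[lebesgue2 R]_(u in B) (s u)%:E + Ssing B)%E].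

(* convex_set needs the R-module structure, carried by R^o * R^o. *)
Record convex_body (R : realType) (A : set (R * R)) : Prop := {
  convex_body_compact : compact A ;
  convex_body_convex : convex_set (A : set (convex_lmodType (R^o * R^o)%type)) ;
  convex_body_interior : (A^°)%classic !=set0
}.

(* The infimum runs over real h. For complex h = h1 + i h2 the variance is
   Var(M 1_A - M h1) + Var(M h2), so complex h would not lower it. *)
Definition linearly_0_rigid (d : measure_display) (T : measurableType d)
    (R : realType) (P : probability T R) (M : (R * R -> R) -> T -> R)
    (A : set (R * R)) : Prop :=
  ereal_inf [set 'V_P[M (\1_A) \- M h] | h in
    [set h | Ccb h /\ forall x, A x -> h x = 0]] = 0%E.

(* Main.v *)
Require Import Defs.
From HB Require Import structures.
From mathcomp Require Import measurable_realfun zify ring lra.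

(** Let [Q g] be the integral against [S] of [power g], the squared modulus of the
    Fourier transform of [g]. If [g] in [Ccb] is equal to 1 on [A], then
    [h = 1_A - g] vanishes on [A] and the variance of [M 1_A - M h] is a constant
    times [Q g]. As [A] is contained in a square, it suffices to find functions
    equal to 1 on a given square with [Q g] arbitrarily small ([small_extension]).

    The classical argument is by duality: an obstruction would be a function [phi] in
    L2(S) such that the measure [phi S] has a compactly supported Fourier transform.
    This measure then has an entire density: it does not charge the singular part of
    [S], and as its density vanishes on the axis [u.2 = 0] near the point (1, 0), it
    vanishes on the whole axis. The proof below is the constructive counterpart of
    each of these facts.

    Analytic continuation along the axis becomes a Taylor expansion: on a bounded
    interval the constant 1 is the C^1 limit of combinations of [x ^+ n * cos (x + t)]
    ([taylor], [taylor_small]), which live at the frequency 1. Multiplied by wide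
    windows in the two variables, such a combination is a bump whose transform is
    concentrated in two thin strips through (1, 0) and (-1, 0) ([bump_power]). There
    the density of [S] is at most a multiple of the square of the second frequency,
    and this beats the height of the bump: off a Lebesgue-null set [N] carrying the
    singular part of [S], the bump has little power ([bump_off_null]).

    On [N] the bump is cancelled by a combination of translates of itself, moved
    off the square. In frequency this multiplies its transform by a trigonometric
    polynomial without low frequencies, which has to be close to 1 on [N] and
    bounded elsewhere. Every Borel set, in particular [N], is approximated by
    trigonometric polynomials with values between 0 and 1, in mean for [S] plus the
    Lebesgue measure on a cell ([measurable_approximable]). As [N] is Lebesgue-null,
    such a polynomial has a small mean, so each of its coefficients is small and the
    low frequencies can be dropped ([singular_multiplier], [multiplier]).

    It remains to correct the bump to be exactly 1 on the square. The power of a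
    function cut to the square is bounded by its squared C^1 norm times [weight]
    ([cut_power_le], [correction_small]), and [weight] is [S]-integrable because the
    variance of [M] at a truncated exponential, whose transform has no zeros, is
    finite ([weight_integrable]). *)

Set Implicit Arguments.
Unset Strict Implicit.
Unset Printing Implicit Defensive.

Local Open Scope classical_set_scope.
Local Open Scope ring_scope.

(** * Compactly supported functions and their power *)

Lemma integrable_EFinZl d (T : measurableType d) (R : realType)
    (mu : {measure set T -> \bar R}) (f : T -> R) (k : R) :
  mu.-integrable [set: T] (EFin \o f) ->
  mu.-integrable [set: T] (EFin \o (fun x => k * f x)).
Proof. by move=> fi; exact: (integrableZl measurableT k fi). Qed.

Lemma integrable_indic_fin d (T : measurableType d) (R : realType)
    (mu : {measure set T -> \bar R}) (A : set T) :
  measurable A -> (mu A < +oo)%E ->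
  mu.-integrable [set: T] (EFin \o (\1_A : T -> R)).
Proof.
move=> mA Afin; apply/integrableP; split; first exact/measurable_EFinP.
under eq_integral do rewrite /= ger0_norm//.
by rewrite integral_indic// setIT.
Qed.

Section Tame.
Variable R : realType.
Implicit Types (g f : R * R -> R) (u x y : R * R) (r : R).

Definition square r : set (borel2 R) := [set x | `|x.1| <= r /\ `|x.2| <= r].

Lemma squareE r : square r = `[- r, r]%classic `*` `[- r, r]%classic.
Proof.
by apply/seteqP; split=> -[a b] /=; rewrite !in_itv/= -!ler_norml.
Qed.

Lemma measurable_square r : measurable (square r).
Proof. by rewrite squareE; apply: measurableX. Qed.

Lemma lebesgue2X (A B : set (measurableTypeR R)) : measurable A -> measurable B ->
  lebesgue2 R (A `*` B) = (lebesgue_measure A * lebesgue_measure B)%E.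
Proof. by move=> mA mB; exact: product_measure1E. Qed.

Lemma lebesgue2_square r : 0 <= r ->
  lebesgue2 R (square r) = ((2 * r) ^+ 2)%:E.
Proof.
move=> r0; rewrite squareE lebesgue2X//.
rewrite !lebesgue_measure_itv/= lte_fin.
case: ifPn => [_|]; first by rewrite -EFinD -EFinM; congr (_%:E); ring.
rewrite -leNgt => rr; have -> : r = 0 by lra.
by rewrite mule0 mulr0 expr0n.
Qed.

Lemma lebesgue2_sigma_finite : sigma_finite setT (lebesgue2 R).
Proof.
exists (fun n => square n%:R).
  apply/seteqP; split=> // x _.
  exists (Num.bound (Num.max `|x.1| `|x.2|)) => //.
  have m0 : 0 <= Num.max `|x.1| `|x.2| by rewrite le_max normr_ge0.
  have := archi_boundP m0.
  by rewrite /square /= gt_max => /andP[/ltW ? /ltW ?].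
move=> n; split; first exact: measurable_square.
by rewrite lebesgue2_square ?ltry.
Qed.

(** A head constant to which the sigma-finiteness of the bundled measure
    [lebesgue2] can be attached. *)
Definition area : set (borel2 R) -> \bar R := lebesgue2 R.
HB.instance Definition _ := Measure.on area.
HB.instance Definition _ := @Measure_isSigmaFinite.Build _ _ _ area
  lebesgue2_sigma_finite.

Definition tame r g := [/\ measurable_fun [set: borel2 R] g,
  exists K, forall x, `|g x| <= K & forall x, ~ square r x -> g x = 0].

Lemma tame_Ccb r g : tame r g -> Ccb g.
Proof.
move=> [mg [K gK] gr]; split=> //.
- exists K; split; first by rewrite num_real.
  by move=> x Kx y _; apply: le_trans (gK y) (ltW Kx).
- have cs : compact (square r : set (R * R)).
    by rewrite squareE; apply: compact_setX; apply: segment_compact.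
  apply: (subclosed_compact _ cs); first exact: closed_closure.
  have /closure_id -> : closed (square r : set (R * R)).
    by apply: compact_closed => //; exact: norm_hausdorff.
  by apply: closure_subset => x /= /eqP gx; apply: contrapT => /gr.
Qed.

Lemma tame_integrable r g : tame r g ->
  (lebesgue2 R).-integrable [set: borel2 R] (EFin \o g).
Proof.
move=> [mg [K gK] gr].
have ms := measurable_square (Num.max r 0).
apply: (@le_integrable _ _ _ (lebesgue2 R) _ measurableT _
    (fun x => (K * \1_(square (Num.max r 0)) x)%:E)).
- exact/measurable_EFinP.
- move=> x _ /=; rewrite lee_fin.
  have K0 : 0 <= K := le_trans (normr_ge0 _) (gK x).
  rewrite indicE; case: (asboolP (square (Num.max r 0) x)) => sx.
    by rewrite mem_set// mulr1 (ger0_norm K0).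
  rewrite gr ?normr0 ?normr_ge0//.
  by move=> [h1 h2]; apply: sx; split; rewrite le_max ?h1 ?h2.
- apply: integrable_EFinZl.
  apply: integrable_indic_fin => //.
  by rewrite lebesgue2_square ?ltry// le_max lexx orbT.
Qed.


Lemma measurable_dot u : measurable_fun [set: borel2 R] (plane_dot u).
Proof.
by apply: measurable_funD; apply: measurable_funM.
Qed.

Lemma tameM_bounded r g (c : R * R -> R) K : tame r g ->
  measurable_fun [set: borel2 R] c -> (forall x, `|c x| <= K) ->
  tame r (fun x => c x * g x).
Proof.
move=> [mg [L gL] gr] mc cK; split.
- exact: measurable_funM.
- by exists (K * L) => x; rewrite normrM ler_pM.
- by move=> x /gr ->; rewrite mulr0.
Qed.

Lemma measurable_cos_dot u (t : R) :
  measurable_fun [set: borel2 R] (fun x => cos (plane_dot u x + t)).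
Proof.
apply: measurableT_comp => //.
  exact: continuous_measurable_fun (@continuous_cos R).
by apply: measurable_funD => //; exact: measurable_dot.
Qed.

(** The phase [t] treats both parts of the Fourier transform at once: [t = 0] gives
    the cosine transform and [t = - pi / 2] the sine transform. *)
Definition phase_int g u (t : R) : R :=
  \int[lebesgue2 R]_x (cos (plane_dot u x + t) * g x).

Lemma tame_cos r g u t : tame r g ->
  tame r (fun x => cos (plane_dot u x + t) * g x).
Proof.
move=> tg; apply: tameM_bounded tg _ _; first exact: measurable_cos_dot.
by move=> x; exact: cos_max.
Qed.

(** The squared modulus of the Fourier transform, see [normc_fourier2]. *)
Definition power g u := phase_int g u 0 ^+ 2 + phase_int g u (- (pi / 2)) ^+ 2.

Lemma normc_fourier2 g u : Normc.normc (fourier2 g u) ^+ 2 = power g u.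
Proof.
rewrite /fourier2 /= sqr_sqrtr ?addr_ge0 ?sqr_ge0// sqrrN.
rewrite /power /phase_int; congr (_ ^+ 2 + _ ^+ 2).
  by apply: eq_Rintegral => x _; rewrite addr0.
by apply: eq_Rintegral => x _; rewrite cosBpihalf.
Qed.

Lemma power_ge0 g u : 0 <= power g u.
Proof. by rewrite addr_ge0 ?sqr_ge0. Qed.

Lemma tame_lin r f g a b : tame r f -> tame r g ->
  tame r (fun x => a * f x + b * g x).
Proof.
move=> [mf [K fK] fr] [mg [L gL] gr]; split.
- by apply: measurable_funD; apply: measurable_funM.
- exists (`|a| * K + `|b| * L) => x; apply: le_trans (ler_normD _ _) _.
  by rewrite !normrM lerD ?ler_wpM2l.
- by move=> x nx; rewrite fr// gr// !mulr0 addr0.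
Qed.

Lemma phase_int_lin r f g a b u t : tame r f -> tame r g ->
  phase_int (fun x => a * f x + b * g x) u t =
  a * phase_int f u t + b * phase_int g u t.
Proof.
move=> tf tg; rewrite /phase_int.
have cf := tame_integrable (tame_cos u t tf).
have cg := tame_integrable (tame_cos u t tg).
transitivity (\int[lebesgue2 R]_x (a * (cos (plane_dot u x + t) * f x) +
    b * (cos (plane_dot u x + t) * g x))).
  by apply: eq_Rintegral => x _; ring.
rewrite RintegralD//; last 2 first.
- exact: integrable_EFinZl.
- exact: integrable_EFinZl.
by rewrite !RintegralZl.
Qed.

Lemma tame_widen r r' g : r <= r' -> tame r g -> tame r' g.
Proof.
move=> rr' [mg bg gr]; split=> // x nx; apply: gr => -[h1 h2]; apply: nx.
by split; [exact: le_trans h1 rr'|exact: le_trans h2 rr'].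
Qed.

Lemma powerD_le r f g u : tame r f -> tame r g ->
  power (fun x => f x + g x) u <= 2 * (power f u + power g u).
Proof.
move=> tf tg.
have h t : phase_int (fun x => f x + g x) u t = phase_int f u t + phase_int g u t.
  rewrite -[RHS](congr2 +%R (mul1r _) (mul1r _)) -(phase_int_lin _ _ _ _ tf tg).
  by congr (phase_int _ u t); apply/funext => x; rewrite !mul1r.
rewrite /power !h.
have := sqr_ge0 (phase_int f u 0 - phase_int g u 0).
have := sqr_ge0 (phase_int f u (- (pi / 2)) - phase_int g u (- (pi / 2))).
nra.
Qed.

(** Integrals over [S] are taken in the frequency variable, hence the need for
    measurability in [u]; it comes from Tonelli on the positive and negative parts. *)
Lemma measurable_phase_int r g t : tame r g ->
  measurable_fun [set: borel2 R] (fun u => phase_int g u t).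
Proof.
move=> tg; have [mg _ _] := tg.
have mf : measurable_fun [set: borel2 R * borel2 R]
    (fun z : borel2 R * borel2 R => cos (plane_dot z.1 z.2 + t) * g z.2).
  apply: measurable_funM; last exact: measurableT_comp mg measurable_snd.
  apply: measurableT_comp.
    exact: continuous_measurable_fun (@continuous_cos R).
  apply: measurable_funD => //; rewrite /plane_dot.
  by apply: measurable_funD; apply: measurable_funM;
    do ?[apply: (measurableT_comp measurable_fst)
        |apply: (measurableT_comp measurable_snd)].
have mf' : measurable_fun [set: borel2 R * borel2 R]
    (fun z : borel2 R * borel2 R => (cos (plane_dot z.1 z.2 + t) * g z.2)%:E).
  exact/measurable_EFinP.
rewrite /phase_int /Rintegral.
apply: measurableT_comp => //.
pose F := fun z : borel2 R * borel2 R =>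
  (cos (plane_dot z.1 z.2 + t) * g z.2)%:E.
have -> : (fun u => (\int[lebesgue2 R]_x (cos (plane_dot u x + t) * g x)%:E)%E) =
    (fubini_F area F^\+ \- fubini_F area F^\-)%E.
  apply/funext => u; rewrite integralE; congr (_ - _)%E.
    by apply: eq_integral => y _; rewrite !funeposE.
  by apply: eq_integral => y _; rewrite !funenegE.
apply: emeasurable_funB.
- exact: (measurable_fun_fubini_tonelli_F _ (measurable_funepos mf')).
- exact: (measurable_fun_fubini_tonelli_F _ (measurable_funeneg mf')).
Qed.

Lemma measurable_power r g : tame r g ->
  measurable_fun [set: borel2 R] (power g).
Proof.
by move=> tg; apply: measurable_funD; apply: measurable_funX;
  exact: measurable_phase_int tg.
Qed.

End Tame.

(** * Translations and products *)

Section Isometries.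
Variable R : realType.
Implicit Types (g : R * R -> R) (u y : R * R) (t r v : R) (a b : R -> R).
Notation leb := (@lebesgue_measure R).

(** Translations serve to shift functions and the reflection to make null sets
    symmetric; one family covers both. *)
Definition line_iso (s : bool) (c : R) : measurableTypeR R -> measurableTypeR R :=
  fun x => (-1) ^+ s * x + c.

Lemma measurable_line_iso s c :
  measurable_fun [set: measurableTypeR R] (line_iso s c).
Proof. by apply: measurable_funD => //; exact: measurable_funM. Qed.

HB.instance Definition _ s c :=
  isMeasurableFun.Build _ _ _ _ (line_iso s c) (measurable_line_iso s c).

Lemma lebesgue_line_iso s c (A : set (measurableTypeR R)) : measurable A ->
  leb (line_iso s c @^-1` A) = leb A.
Proof.
move=> mA; symmetry.
apply: (@lebesgue_measure_unique R (pushforward leb (line_iso s c))) => //.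
move=> _ [[a b] _ <-].
change (leb `]a, b]%classic = leb (line_iso s c @^-1` `]a, b]%classic)).
case: s.
  have -> : line_iso true c @^-1` `]a, b]%classic = `[c - b, c - a[%classic.
    apply/seteqP; split=> x /=; rewrite !in_itv/= /line_iso expr1;
    move=> /andP[h1 h2]; apply/andP; split; lra.
  rewrite !lebesgue_measure_itv/= !lte_fin.
  have -> : (c - b < c - a) = (a < b) by rewrite ltrD2l ltrN2.
  by case: ifP => // _; rewrite -!EFinD; congr (_%:E); ring.
have -> : line_iso false c @^-1` `]a, b]%classic = `]a - c, b - c]%classic.
  apply/seteqP; split=> x /=; rewrite !in_itv/= /line_iso expr0;
  move=> /andP[h1 h2]; apply/andP; split; lra.
rewrite !lebesgue_measure_itv/= !lte_fin.
have -> : (a - c < b - c) = (a < b) by rewrite ltrD2r.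
by case: ifP => // _; rewrite -!EFinD; congr (_%:E); ring.
Qed.

Definition plane_iso (s : bool) (c : R * R) : borel2 R -> borel2 R :=
  fun x => (line_iso s c.1 x.1, line_iso s c.2 x.2).

Lemma measurable_plane_iso s c : measurable_fun [set: borel2 R] (plane_iso s c).
Proof.
by apply/measurable_fun_pair; apply: measurableT_comp => //;
  exact: measurable_line_iso.
Qed.

HB.instance Definition _ s c :=
  isMeasurableFun.Build _ _ _ _ (plane_iso s c) (measurable_plane_iso s c).

Lemma lebesgue2_iso s c (A : set (borel2 R)) : measurable A ->
  lebesgue2 R (plane_iso s c @^-1` A) = lebesgue2 R A.
Proof.
move=> mA; symmetry.
apply: (@product_measure_unique _ _ (measurableTypeR R) (measurableTypeR R) R
   leb leb (pushforward (lebesgue2 R) (plane_iso s c))) => //.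
move=> B C mB mC.
change (lebesgue2 R ((line_iso s c.1 @^-1` B) `*` (line_iso s c.2 @^-1` C)) =
  (leb B * leb C)%E).
rewrite lebesgue2X; last 2 first.
- by rewrite -[X in measurable X]setTI; exact: measurable_line_iso.
- by rewrite -[X in measurable X]setTI; exact: measurable_line_iso.
by congr (_ * _)%E; exact: lebesgue_line_iso.
Qed.

Lemma tame_iso s c r g : tame r g ->
  tame (r + Num.max `|c.1| `|c.2|) (g \o plane_iso s c).
Proof.
move=> [mg [K gK] gr]; split.
- exact: (measurableT_comp mg (measurable_plane_iso s c)).
- by exists K => x; exact: gK.
- move=> x nx; apply: gr => -[h1 h2]; apply: nx; rewrite /square /=.
  have h (a b : R) : `|line_iso s b a| <= r -> `|a| <= r + `|b|.
    rewrite /line_iso => h3.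
    rewrite -[`|a|]mul1r -(normr_sign R s) -normrM.
    rewrite -(addrK b (_ * a)); apply: le_trans (ler_normB _ _) _.
    by rewrite lerD2r.
  split; [apply: le_trans (h _ _ h1) _|apply: le_trans (h _ _ h2) _];
    by rewrite lerD2l le_max lexx ?orbT.
Qed.

Lemma Rintegral_iso s c r g : tame r g ->
  \int[lebesgue2 R]_x g (plane_iso s c x) = \int[lebesgue2 R]_x g x.
Proof.
move=> tg; have [mg _ _] := tg; rewrite /Rintegral; congr fine.
transitivity (\int[pushforward (lebesgue2 R) (plane_iso s c)]_x (g x)%:E)%E; last first.
  by apply: eq_measure_integral => A mA _; exact: lebesgue2_iso.
rewrite integral_pushforward//.
- exact/measurable_EFinP.
- exact: tame_integrable (tame_iso s c tg).
Qed.

Lemma phase_int_shift r g y u t : tame r g ->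
  phase_int (fun x => g (x - y)) u t = phase_int g u (t + plane_dot u y).
Proof.
move=> tg; rewrite /phase_int.
rewrite -(@Rintegral_iso false (- y) r
  (fun x => cos (plane_dot u x + (t + plane_dot u y)) * g x)); last exact: tame_cos.
apply: eq_Rintegral => x _.
have -> : plane_iso false (- y) x = x - y.
  by rewrite /plane_iso /line_iso expr0 !mul1r; case: x; case: y.
congr (cos _ * _); rewrite /plane_dot /=; ring.
Qed.

End Isometries.

Section Product.
Variable R : realType.
Implicit Types (g : R * R -> R) (u y : R * R) (t r v : R) (a b : R -> R).
Notation leb := (@lebesgue_measure R).

Definition tame1 r (a : R -> R) := [/\ measurable_fun [set: measurableTypeR R] a,
  exists K, forall x, `|a x| <= K & forall x, r < `|x| -> a x = 0].

Definition phase_int1 (a : R -> R) v t : R := \int[leb]_x (cos (v * x + t) * a x).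

Definition power1 a v := phase_int1 a v 0 ^+ 2 + phase_int1 a v (- (pi / 2)) ^+ 2.

Lemma tame1_integrable r a : tame1 r a -> leb.-integrable setT (EFin \o a).
Proof.
move=> [ma [K aK] ar].
apply: (@le_integrable _ _ _ leb _ measurableT _
    (fun x => (K * \1_(`[- r, r]%classic) x)%:E)).
- exact/measurable_EFinP.
- move=> x _ /=; rewrite lee_fin.
  have K0 : 0 <= K := le_trans (normr_ge0 _) (aK x).
  rewrite indicE; case: (asboolP (`[- r, r]%classic x)) => sx.
    by rewrite mem_set// mulr1 (ger0_norm K0).
  rewrite ar ?normr0 ?normr_ge0//.
  by rewrite ltNge; apply/negP => xr; apply: sx; rewrite /= in_itv/= -ler_norml.
- have fin : (leb `[(- r)%R, r]%classic < +oo)%E.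
    by rewrite lebesgue_measure_itv/=; case: ifP; rewrite // -EFinD ltry.
  by apply: integrable_EFinZl; exact: integrable_indic_fin.
Qed.

Lemma tame1_cos r a v t : tame1 r a -> tame1 r (fun x => cos (v * x + t) * a x).
Proof.
move=> [ma [K aK] ar]; split.
- apply: measurable_funM => //; apply: measurableT_comp => //.
    exact: continuous_measurable_fun (@continuous_cos R).
  by apply: measurable_funD => //; exact: measurable_funM.
- exists K => x; rewrite normrM -[leRHS]mul1r ler_pM//; exact: cos_max.
- by move=> x /ar ->; rewrite mulr0.
Qed.

Lemma tame_prod r a b : tame1 r a -> tame1 r b ->
  tame r (fun x => a x.1 * b x.2).
Proof.
move=> [ma [K aK] ar] [mb [L bL] br]; split.
- by apply: measurable_funM; [exact: measurableT_comp ma _|exact: measurableT_comp mb _].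
- by exists (K * L) => x; rewrite normrM ler_pM.
- move=> x /not_andP[] /negP; rewrite -ltNge => h; first by rewrite ar// mul0r.
  by rewrite br// mulr0.
Qed.

Lemma Rintegral_prod r a b : tame1 r a -> tame1 r b ->
  \int[lebesgue2 R]_x (a x.1 * b x.2) = (\int[leb]_x a x) * (\int[leb]_x b x).
Proof.
move=> ta tb; have ia := tame1_integrable ta; have ib := tame1_integrable tb.
have iab := tame_integrable (tame_prod ta tb).
transitivity (fine (\int[leb]_x \int[leb]_y (a x * b y)%:E)%E).
  congr fine; symmetry.
  exact: (@integral12_prod_meas1 _ _ (measurableTypeR R) (measurableTypeR R) R leb leb _ iab).
transitivity (\int[leb]_x (a x * \int[leb]_y b y)).
  congr fine; apply: eq_integral => x _.
  rewrite EFinM /Rintegral fineK; last exact: integrable_fin_num.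
  by rewrite -integralZl.
by rewrite RintegralZr.
Qed.

Lemma phase_int_prod r a b u t : tame1 r a -> tame1 r b ->
  phase_int (fun x => a x.1 * b x.2) u t =
  phase_int1 a u.1 0 * phase_int1 b u.2 t -
  phase_int1 a u.1 (- (pi / 2)) * phase_int1 b u.2 (t - pi / 2).
Proof.
move=> ta tb; rewrite /phase_int1.
have tc v s := tame1_cos v s ta; have td v s := tame1_cos v s tb.
rewrite -!(Rintegral_prod (tc _ _) (td _ _)) -RintegralB//; last 2 first.
- exact: tame_integrable (tame_prod (tc _ _) (td _ _)).
- exact: tame_integrable (tame_prod (tc _ _) (td _ _)).
apply: eq_Rintegral => x _ /=.
rewrite /plane_dot addr0 addrA !cosBpihalf -addrA cosD; ring.
Qed.

(** The square modulus of a product is the product of the square moduli; in real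
    terms this is the two-squares identity. *)
Lemma power_prod r a b u : tame1 r a -> tame1 r b ->
  power (fun x => a x.1 * b x.2) u = power1 a u.1 * power1 b u.2.
Proof.
move=> ta tb; rewrite /power !(phase_int_prod _ _ ta tb) sub0r.
have -> : phase_int1 b u.2 (- (pi / 2) - pi / 2) = - phase_int1 b u.2 0.
  rewrite /phase_int1 -[RHS]mulN1r -RintegralZl//; last first.
    exact: tame1_integrable (tame1_cos _ _ tb).
  apply: eq_Rintegral => x _.
  have -> : u.2 * x + (- (pi / 2) - pi / 2) = u.2 * x - pi by field.
  by rewrite cosB cospi sinpi mulr0 !addr0 mulrN1 mulN1r mulNr.
rewrite /power1; ring.
Qed.

End Product.

(** * Windowed oscillations of frequency one *)

Section Oscillatory.
Variable R : realType.
Implicit Types (t r v T : R) (a b phi : R -> R) (P Q : {poly R}).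
Notation leb := (@lebesgue_measure R).

Definition C1 phi phi' := (forall x : R, is_derive x 1 phi (phi' x)) /\
  continuous (phi' : R -> R).

Lemma derive_continuous phi phi' : (forall x : R, is_derive x 1 phi (phi' x)) ->
  continuous phi.
Proof.
move=> d x; apply/differentiable_continuous/derivable1_diffP.
by have [] := d x.
Qed.

Lemma C1_oo phi phi' l r : C1 phi phi' -> derivable_oo_LRcontinuous phi l r.
Proof.
move=> [d _]; have c := derive_continuous d; split.
- by move=> x _; have [] := d x.
- exact: cvg_at_right_filter (c l).
- exact: cvg_at_left_filter (c r).
Qed.

Lemma is_derive_affine (v t x : R) : is_derive x 1 (fun y : R => v * y + t) v.
Proof.
have := is_derive_poly (v *: 'X + t%:P) x.
rewrite derivD derivZ derivX derivC addr0 hornerZ hornerC mulr1.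
by congr (is_derive _ _ _ _); apply/funext => y; rewrite !hornerE.
Qed.

Lemma is_derive_cos_affine (v t x : R) :
  is_derive x 1 (fun y : R => cos (v * y + t)) (- sin (v * x + t) * v).
Proof.
by apply: (@is_derive1_comp _ cos (fun y : R => v * y + t));
  exact: is_derive_affine.
Qed.

Lemma is_derive_sin_affine (v t x : R) :
  is_derive x 1 (fun y : R => sin (v * y + t)) (cos (v * x + t) * v).
Proof.
by apply: (@is_derive1_comp _ sin (fun y : R => v * y + t));
  exact: is_derive_affine.
Qed.

(** Truncation by an indicator keeps the boundary terms of integrations by parts
    explicit. *)
Definition cut r phi := fun x => if `|x| <= r then phi x else 0.

Lemma integrable_cc (f : R -> R) l r : continuous f ->
  leb.-integrable `[l, r]%classic (EFin \o f).
Proof.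
move=> cf; apply: continuous_compact_integrable; first exact: segment_compact.
exact: continuous_subspaceT.
Qed.

Lemma tame1_cut r phi : continuous phi -> tame1 r (cut r phi).
Proof.
move=> cphi.
have cutE : cut r phi = phi \_ `[- r, r].
  by apply/funext => x; rewrite /cut patchE mem_setE in_itv/= -ler_norml.
split.
- rewrite cutE; apply/(measurable_restrictT phi) => //.
  by apply: measurable_funTS; exact: continuous_measurable_fun.
- have := @compact_bounded R R^o (phi @` `[- r, r]%classic).
  case.
    apply: continuous_compact; last exact: segment_compact.
    exact: continuous_subspaceT.
  move=> M [_ /(_ (`|M| + 1)) hM]; exists (`|M| + 1) => x.
  rewrite /cut; case: ifPn => xr; last by rewrite normr0 addr_ge0.
  apply: hM; first by rewrite (le_lt_trans (ler_norm _))// ltrDl.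
  by exists x => //=; rewrite in_itv/= -ler_norml.
- by move=> x rx; rewrite /cut leNgt rx.
Qed.

Lemma phase_int1_cut r phi v t :
  phase_int1 (cut r phi) v t = \int[leb]_(x in `[- r, r]) (cos (v * x + t) * phi x).
Proof.
rewrite /phase_int1 [RHS]Rintegral_mkcond; apply: eq_Rintegral => x _.
by rewrite /cut patchE mem_setE in_itv/= -ler_norml; case: ifP; rewrite ?mulr0.
Qed.

Lemma continuous_cos_affine v t : continuous (fun x : R => cos (v * x + t)).
Proof. exact: derive_continuous (is_derive_cos_affine v t). Qed.

Lemma continuous_sin_affine v t : continuous (fun x : R => sin (v * x + t)).
Proof. exact: derive_continuous (is_derive_sin_affine v t). Qed.

Lemma phase_int1_cut_le r phi v t K : 0 <= r -> continuous phi ->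
  (forall x, `|x| <= r -> `|phi x| <= K) ->
  `|phase_int1 (cut r phi) v t| <= 2 * r * K.
Proof.
move=> r0 cphi phiK; rewrite phase_int1_cut.
have cf : continuous (fun x : R => cos (v * x + t) * phi x).
  by move=> x; apply: cvgM; [exact: continuous_cos_affine|exact: cphi].
apply: le_trans (le_normr_Rintegral _ (integrable_cc _ _ cf)) _ => //.
have -> : 2 * r * K = \int[leb]_(x in `[- r, r]) K.
  have h : leb `[(- r)%R, r]%classic = (2 * r)%:E.
    rewrite lebesgue_measure_itv/= lte_fin.
    case: ifPn => [_|]; first by rewrite -EFinD; congr (_%:E); ring.
    rewrite -leNgt => rNr; have r00 : r = 0 by lra.
    by rewrite r00 mulr0.
  by rewrite Rintegral_cst// [X in fine X](h) mulrC.
apply: le_Rintegral => //.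
- apply: (integrable_cc (f := fun x => `|cos (v * x + t) * phi x|)) => x.
  exact: cvg_norm (cf x).
- by apply: (integrable_cc (f := fun=> K)); exact: cst_continuous.
- move=> x; rewrite /= in_itv/= -ler_norml => xr.
  by rewrite normrM -[leRHS]mul1r ler_pM ?cos_max ?phiK.
Qed.

(** A factor [v] costs the two boundary values and one derivative; the sine that
    appears is absorbed in the phase. *)
Lemma phase_int1_ibp r phi phi' v t : 0 < r -> C1 phi phi' ->
  v * phase_int1 (cut r phi) v t =
  sin (v * r + t) * phi r - sin (v * - r + t) * phi (- r)
  + phase_int1 (cut r phi') v (t + pi / 2).
Proof.
move=> r0 Cphi; have [dphi cphi'] := Cphi; have cphi := derive_continuous dphi.
rewrite !phase_int1_cut.
rewrite -RintegralZl//; last first.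
  apply: integrable_cc => x; apply: cvgM; last exact: cphi.
  exact: continuous_cos_affine.
have Cs : C1 (fun x => sin (v * x + t)) (fun x => cos (v * x + t) * v).
  split; first exact: is_derive_sin_affine.
  by move=> x; apply: cvgM; [exact: continuous_cos_affine|exact: cvg_cst].
have rr : - r < r by lra.
have := Rintegration_by_parts rr (continuous_subspaceT cphi')
  (C1_oo (- r) r Cphi) _ (continuous_subspaceT Cs.2) (C1_oo (- r) r Cs) _.
move=> /(_ _ _)/wrap[||ibp].
- by move=> x _; rewrite derive1E; have [_ ->] := dphi x.
- by move=> x _; rewrite derive1E; have [_ ->] := Cs.1 x.
transitivity (\int[leb]_(x in `[(- r), r]) (phi x * (cos (v * x + t) * v))).
  by apply: eq_Rintegral => x _; ring.
rewrite ibp (mulrC (phi r)) (mulrC (phi (- r))); congr (_ + _).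
rewrite -mulN1r -RintegralZl//; last first.
  by apply: integrable_cc => x; apply: cvgM; [exact: cphi'|exact: continuous_sin_affine].
by apply: eq_Rintegral => x _; rewrite addrA cosDpihalf; ring.
Qed.

Lemma phase_int1_lin r a b (k l : R) v t : tame1 r a -> tame1 r b ->
  phase_int1 (fun x => k * a x + l * b x) v t =
  k * phase_int1 a v t + l * phase_int1 b v t.
Proof.
move=> ta tb; rewrite /phase_int1.
have ca := tame1_integrable (tame1_cos v t ta).
have cb := tame1_integrable (tame1_cos v t tb).
transitivity (\int[leb]_x (k * (cos (v * x + t) * a x) + l * (cos (v * x + t) * b x))).
  by apply: eq_Rintegral => x _; ring.
rewrite RintegralD//; last 2 first.
- exact: integrable_EFinZl.
- exact: integrable_EFinZl.
by rewrite !RintegralZl.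
Qed.

Definition window_int P T v t := phase_int1 (cut T (fun x : R => P.[x / T])) v t.

Lemma C1_scaled P T : C1 (fun x : R => P.[x / T]) (fun x : R => T^-1 * P^`().[x / T]).
Proof.
split=> x.
  rewrite mulrC; apply: (@is_derive1_comp _ (horner P) (fun x : R => x / T)).
  have := is_derive_affine T^-1 0 x.
  by congr (is_derive _ _ _ _); apply/funext => y; rewrite addr0 mulrC.
have cP : continuous (fun x : R => P^`().[x / T]).
  move=> y; apply: (@continuous_comp _ _ _ (fun x : R => x / T) (horner P^`())).
    by apply: cvgM; [exact: cvg_id|exact: cvg_cst].
  exact: continuous_horner.
by apply: cvgM; [exact: cvg_cst|exact: cP].
Qed.

Lemma continuous_scaled P T : continuous (fun x : R => P.[x / T]).
Proof. by have [d _] := C1_scaled P T; exact: derive_continuous d. Qed.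

Definition poly_bound P : R := \sum_(i < size P) `|P`_i|.

Lemma poly_bound_ge0 P : 0 <= poly_bound P.
Proof. by apply: sumr_ge0. Qed.

Lemma horner_le P (y : R) : `|y| <= 1 -> `|P.[y]| <= poly_bound P.
Proof.
move=> y1; rewrite horner_coef; apply: le_trans (ler_norm_sum _ _ _) _.
apply: ler_sum => i _; rewrite normrM normrX -[leRHS]mulr1.
by rewrite ler_wpM2l// exprn_ile1.
Qed.

Lemma scaled_le1 (x T : R) : 0 < T -> (`|x / T| <= 1) = (`|x| <= T).
Proof. by move=> T0; rewrite normrM normfV (gtr0_norm T0) ler_pdivrMr// mul1r. Qed.

Lemma window_int_le P T v t : 0 < T ->
  `|window_int P T v t| <= (2 * poly_bound P) * T.
Proof.
move=> T0; have -> : 2 * poly_bound P * T = 2 * T * poly_bound P by ring.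
apply: phase_int1_cut_le; [exact: ltW|exact: continuous_scaled|].
by move=> x xT; apply: horner_le; rewrite scaled_le1.
Qed.

Lemma window_int_step P T v t : 0 < T -> root P 1 -> root P (-1) ->
  (T * v) * window_int P T v t = window_int P^`() T v (t + pi / 2).
Proof.
move=> T0 /rootP P1 /rootP PN1.
have Tn0 : T != 0 by rewrite gt_eqF.
rewrite -mulrA (phase_int1_ibp v t T0 (C1_scaled P T)).
rewrite mulNr divff// P1 PN1 !mulr0 subrr add0r.
have tc := tame1_cut T (@continuous_scaled P^`() T).
have -> : cut T (fun x : R => T^-1 * P^`().[x / T]) =
    (fun x : R => T^-1 * cut T (fun x : R => P^`().[x / T]) x +
      0 * cut T (fun x : R => P^`().[x / T]) x).
  by apply/funext => x; rewrite /cut; case: ifP; rewrite ?mulr0 ?mul0r ?addr0.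
by rewrite (phase_int1_lin _ _ _ _ tc tc) mul0r addr0 mulrA divff// mul1r.
Qed.

Definition window : {poly R} := 1 - 'X ^+ 2.

(** Each integration by parts lowers by one the order of vanishing at the two
    ends of the window and gains a factor [T * v]. *)
Lemma window_int_decay k P : (exists Q, P = Q * window ^+ k) ->
  exists C : R, 0 <= C /\ forall T v t, 0 < T ->
    `|T * v| ^+ k * `|window_int P T v t| <= C * T.
Proof.
elim: k P => [|k IH] P [Q PE].
  exists (2 * poly_bound P); split; first by rewrite mulr_ge0 ?poly_bound_ge0.
  by move=> T v t T0; rewrite expr0 mul1r window_int_le.
have [|C [C0 hC]] := IH P^`().
  exists (Q^`() * window + Q * window^`() *+ k.+1).
  rewrite PE derivM deriv_exp /=.
  rewrite mulrDl -mulrA -exprS; congr (_ + _).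
  by rewrite mulrnAr mulrnAl mulrA mulrAC.
exists C; split=> // T v t T0.
have [P1 PN1] : root P 1 /\ root P (-1).
  by split; apply/rootP; rewrite PE hornerM horner_exp /window hornerD hornerN
    hornerXn hornerC ?sqrrN expr1n subrr exprS mul0r mulr0.
rewrite exprSr -mulrA -normrM window_int_step//.
exact: hC.
Qed.

(** The Taylor expansion of [cos (x + h)] at [h = - x], whose value is 1. Each term is
    a polynomial times an oscillation of frequency exactly 1, so that the constant 1
    is approximated on bounded intervals by functions living at that frequency. *)
Definition taylor N (x : R) :=
  \sum_(n < N) ((- x) ^+ n / n`!%:R * cos (x + n%:R * (pi / 2))).

Definition carrier N m T := cut T (fun x => taylor N x * (window ^+ m).[x / T]).

(** The derivative telescopes: only the last term survives. *)
Lemma is_derive_taylor N (x : R) : is_derive x 1 (taylor N.+1)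
  ((- x) ^+ N / N`!%:R * cos (x + N.+1%:R * (pi / 2))).
Proof.
have dcos (c : R) : is_derive x 1 (fun y : R => cos (y + c)) (- sin (x + c)).
  have := is_derive_cos_affine 1 c x; rewrite mulr1 mul1r.
  by congr (is_derive _ _ _ _); apply/funext => y; rewrite mul1r.
elim: N => [|N IH].
  have -> : taylor 1 = fun y : R => cos (y + 0).
    by apply/funext => y; rewrite /taylor big_ord1 expr0 fact0 divr1 !mul1r mul0r.
  apply: is_derive_eq; rewrite expr0 fact0 divr1 !mul1r cosDpihalf addr0.
  by [].
have -> : taylor N.+2 = taylor N.+1 +
    (fun y : R => ((- y) ^+ N.+1 / N.+1`!%:R) * cos (y + N.+1%:R * (pi / 2))).
  by apply/funext => y; rewrite /taylor big_ord_recr.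
have dp : is_derive x 1 (fun y : R => (- y) ^+ N.+1 / N.+1`!%:R)
    (- ((- x) ^+ N / N`!%:R)).
  have := is_derive_poly (((- 1) ^+ N.+1 / N.+1`!%:R) *: 'X^(N.+1)) x.
  rewrite derivZ derivXn /= hornerZ hornerMn hornerXn.
  have -> : (-1) ^+ N.+1 / (N.+1)`!%:R * (x ^+ N *+ N.+1) = - ((- x) ^+ N / N`!%:R).
    rewrite exprS (exprNn x N) factS natrM -mulr_natr.
    have fact0 : (N`!)%:R != 0 :> R by rewrite pnatr_eq0 -lt0n fact_gt0.
    by field; rewrite fact0 ?nat1r ?natr1 pnatr_eq0.
  congr (is_derive _ _ _ _); apply/funext => y.
  by rewrite hornerZ hornerXn (exprNn y N.+1); ring.
apply: (is_derive_eq (is_deriveD _ (is_deriveM dp (dcos _)))).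
have -> : x + N.+2%:R * (pi / 2) = (x + N.+1%:R * (pi / 2)) + pi / 2 :> R.
  by rewrite -[N.+2]addn1 natrD; ring.
by rewrite cosDpihalf /GRing.scale /=; ring.
Qed.

Lemma continuous_taylor N : continuous (taylor N).
Proof.
case: N => [|N]; last exact: derive_continuous (is_derive_taylor N).
have -> : taylor 0 = fun=> 0 by apply/funext => y; rewrite /taylor big_ord0.
exact: cst_continuous.
Qed.

Lemma carrier_tame N m T : tame1 T (carrier N m T).
Proof.
apply: tame1_cut => x; apply: cvgM; first exact: continuous_taylor.
exact: continuous_scaled.
Qed.

(** Modulation shifts the frequency by one in both directions. *)
Lemma phase_int1_modulated P T (th : R) v s :
  phase_int1 (cut T (fun x : R => P.[x / T] * cos (x + th))) v s =
  2^-1 * window_int P T (v + 1) (s + th) + 2^-1 * window_int P T (v - 1) (s - th).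
Proof.
have tc := tame1_cut T (@continuous_scaled P T).
have i1 := tame1_integrable (tame1_cos (v + 1) (s + th) tc).
have i2 := tame1_integrable (tame1_cos (v - 1) (s - th) tc).
rewrite /window_int /phase_int1 -!RintegralZl// -RintegralD//; last 2 first.
- exact: integrable_EFinZl.
- exact: integrable_EFinZl.
apply: eq_Rintegral => x _; rewrite /cut; case: ifP => _; last by rewrite !mulr0 addr0.
have -> : (v + 1) * x + (s + th) = (v * x + s) + (x + th) by ring.
have -> : (v - 1) * x + (s - th) = (v * x + s) - (x + th) by ring.
by rewrite (cosD (v * x + s)) (cosB (v * x + s)); field.
Qed.

(** Term by term: the monomials of [taylor] cost powers of [T], while the vanishing
    of the window at its ends gains [(T * d) ^+ m] at distance [d] from [1] and [-1]. *)
Lemma carrier_decay N m : exists C : R, 0 <= C /\ forall T v s (d : R), 1 <= T -> 0 <= d ->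
  d <= `|v - 1| -> d <= `|v + 1| ->
    `|phase_int1 (carrier N m T) v s| <= C * T ^+ N /\
    (T * d) ^+ m * `|phase_int1 (carrier N m T) v s| <= C * T ^+ N.
Proof.
elim: N => [|N [C [C0 hC]]].
  exists 0; split=> // T v s d T1 d0 _ _.
  have -> : phase_int1 (carrier 0 m T) v s = 0.
    rewrite /phase_int1 /Rintegral integral0_eq// => x _.
    by rewrite /carrier /cut /taylor big_ord0 mul0r if_same mulr0.
  by rewrite normr0 mulr0 mul0r.
pose P : {poly R} := 'X^N * window ^+ m.
have [|C1 [C10 hC1]] := @window_int_decay m P; first by exists 'X^N.
pose C2 := Num.max C1 (2 * poly_bound P).
exists (C + C2); split; first by rewrite addr_ge0// le_max C10.
move=> T v s d T1 d0 dv1 dv2; have T0 : 0 < T by lra.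
have Tn0 : T != 0 by rewrite gt_eqF.
pose k : R := (-1) ^+ N / N`!%:R * T ^+ N.
pose th : R := N%:R * (pi / 2).
have tP : tame1 T (cut T (fun x : R => P.[x / T] * cos (x + th))).
  apply: tame1_cut => x; apply: cvgM; first exact: continuous_scaled.
  have cth : continuous (fun y : R => cos (y + th)).
    have -> : (fun y : R => cos (y + th)) = (fun y => cos (1 * y + th)).
      by apply/funext => y; rewrite mul1r.
    exact: continuous_cos_affine.
  exact: cth.
have cE : carrier N.+1 m T =
    (fun x => 1 * carrier N m T x + k * cut T (fun x : R => P.[x / T] * cos (x + th)) x).
  apply/funext => x; rewrite /carrier /cut; case: ifP => _; last by rewrite !mulr0 addr0.
  rewrite /taylor big_ord_recr /= mulrDl mul1r; congr (_ + _).
  rewrite /P hornerM hornerXn -/th exprMn exprVn /k.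
  rewrite (exprNn x N).
  have TNn0 : T ^+ N != 0 by rewrite expf_neq0.
  have fact0 : (N`!)%:R != 0 :> R by rewrite pnatr_eq0 -lt0n fact_gt0.
  by field; rewrite TNn0 fact0.
rewrite cE (phase_int1_lin _ _ _ _ (carrier_tame N m T) tP) mul1r.
set p0 := phase_int1 (carrier N m T) v s.
set p1 := phase_int1 _ v s.
have [h1 h2] := hC T v s d T1 d0 dv1 dv2.
have kT : `|k| <= T ^+ N.
  rewrite /k !normrM normr_sign mul1r normfV normr_nat normrX (gtr0_norm T0).
  rewrite -[leRHS]mul1r ler_wpM2r ?exprn_ge0 ?(ltW T0)//.
  by rewrite invf_le1 ?ltr0n ?fact_gt0// ler1n fact_gt0.
have half (A B : R) M : `|A| <= M -> `|B| <= M -> `|2^-1 * A + 2^-1 * B| <= M.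
  move=> hA hB; apply: le_trans (ler_normD _ _) _; rewrite !normrM.
  by rewrite (gtr0_norm (x := 2^-1)) ?invr_gt0//; lra.
have p1E : p1 = _ := phase_int1_modulated P T th v s.
have q1 : `|p1| <= C2 * T.
  rewrite p1E; apply: half; apply: le_trans (window_int_le _ _ _ T0) _;
  by rewrite ler_wpM2r ?(ltW T0)// le_max lexx orbT.
have q2 : (T * d) ^+ m * `|p1| <= C2 * T.
  have Td0 : 0 <= (T * d) ^+ m by rewrite exprn_ge0// mulr_ge0// ltW.
  rewrite -(ger0_norm Td0) -normrM p1E mulrDr !mulrA !(mulrC _ 2^-1) -!mulrA.
  have q3 w th' : d <= `|w| -> `|(T * d) ^+ m * window_int P T w th'| <= C2 * T.
    move=> dw; rewrite normrM (ger0_norm Td0).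
    apply: (@le_trans _ _ (C1 * T)); last by rewrite ler_wpM2r ?(ltW T0)// le_max lexx.
    apply: le_trans (hC1 T w th' T0); rewrite ler_wpM2r//.
    by rewrite lerXn2r ?nnegrE ?mulr_ge0 ?(ltW T0)// normrM (gtr0_norm T0) ler_wpM2l// ltW.
  by apply: half; apply: q3.
have TN : T ^+ N <= T ^+ N.+1 by apply: ler_weXn2l.
have fin Y q : 0 <= Y -> Y * `|p0| <= C * T ^+ N -> Y * `|q| <= C2 * T ->
    Y * `|p0 + k * q| <= (C + C2) * T ^+ N.+1.
  move=> Y0 y1 y2; apply: (@le_trans _ _ (Y * `|p0| + `|k| * (Y * `|q|))).
    rewrite mulrCA -mulrDr ler_wpM2l//; apply: le_trans (ler_normD _ _) _.
    by rewrite normrM.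
  rewrite mulrDl lerD//; first by apply: le_trans y1 _; rewrite ler_wpM2l.
  apply: (@le_trans _ _ (T ^+ N * (C2 * T))); last by rewrite exprSr; lra.
  by apply: ler_pM => //; rewrite mulr_ge0.
split; first by rewrite -[leLHS]mul1r; apply: fin => //; rewrite mul1r.
by apply: fin => //; rewrite exprn_ge0// mulr_ge0// ltW.
Qed.

End Oscillatory.

(** * Bumps and corrections on a square *)

Section Bump.
Variable R : realType.
Implicit Types (t r v T : R) (a b phi : R -> R) (P Q : {poly R}) (u : R * R).
Notation leb := (@lebesgue_measure R).

(** The decay rate of the power of a truncated smooth function: one integration by
    parts in each variable. *)
Definition weight1 v : R := (1 + v ^+ 2)^-1.
Definition weight u : R := weight1 u.1 * weight1 u.2.

Lemma weight1_gt0 v : 0 < weight1 v.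
Proof. by rewrite invr_gt0 ltr_pwDl// sqr_ge0. Qed.

Lemma weight_gt0 u : 0 < weight u.
Proof. by rewrite mulr_gt0 ?weight1_gt0. Qed.

Lemma ler_weight1 v (A B : R) : (1 + v ^+ 2) * A <= B -> A <= B * weight1 v.
Proof.
have v0 : 0 < 1 + v ^+ 2 by rewrite ltr_pwDl// sqr_ge0.
by rewrite /weight1 ler_pdivlMr// mulrC.
Qed.

(** One integration by parts, the jumps at the ends being bounded as well: this is
    what makes corrections that are small in C^1 cheap. *)
Lemma cut_power_le r phi phi' (K0 K1 : R) v : 0 < r -> C1 phi phi' ->
  (forall x, `|x| <= r -> `|phi x| <= K0) ->
  (forall x, `|x| <= r -> `|phi' x| <= K1) ->
  power1 (cut r phi) v <=
    (2 * ((2 * r * K0) ^+ 2 + (2 * K0 + 2 * r * K1) ^+ 2)) * weight1 v.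
Proof.
move=> r0 Cphi phiK phi'K; have [dphi cphi'] := Cphi.
have cphi := derive_continuous dphi.
apply: ler_weight1.
have K00 : 0 <= K0 := le_trans (normr_ge0 _) (phiK r (ltac:(by rewrite gtr0_norm))).
have K10 : 0 <= K1 := le_trans (normr_ge0 _) (phi'K r (ltac:(by rewrite gtr0_norm))).
have h0 t : phase_int1 (cut r phi) v t ^+ 2 <= (2 * r * K0) ^+ 2.
  rewrite -real_normK ?num_real// lerXn2r ?nnegrE//.
    by rewrite !mulr_ge0// ltW.
  by apply: phase_int1_cut_le => //; exact: ltW.
have h1 t : (v * phase_int1 (cut r phi) v t) ^+ 2 <= (2 * K0 + 2 * r * K1) ^+ 2.
  rewrite -real_normK ?num_real// lerXn2r ?nnegrE//.
    by rewrite addr_ge0// !mulr_ge0// ltW.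
  rewrite (phase_int1_ibp v t r0 Cphi).
  apply: le_trans (ler_normD _ _) _; apply: lerD.
    apply: le_trans (ler_normB _ _) _.
    have -> : 2 * K0 = K0 + K0 by ring.
    have hs (x y : R) : `|y| <= K0 -> `|sin x * y| <= K0.
      by move=> yK; rewrite normrM -[leRHS]mul1r ler_pM ?sin_max.
    by apply: lerD; apply: hs; apply: phiK; rewrite ?normrN gtr0_norm.
  by apply: phase_int1_cut_le => //; exact: ltW.
rewrite /power1.
have := h0 0; have := h0 (- (pi / 2)); have := h1 0; have := h1 (- (pi / 2)).
rewrite !exprMn; nra.
Qed.

(** The derivative is a term of the exponential series, and the value at 0 is 1. *)
Lemma taylor_small r (e : R) : 0 < r -> 0 < e -> exists N, forall x, `|x| <= r ->
  `|taylor N.+1 x - 1| <= e /\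
  `|(- x) ^+ N / N`!%:R * cos (x + N.+1%:R * (pi / 2))| <= e.
Proof.
move=> r0 e0; pose e' := Num.min e (e / r).
have e'0 : 0 < e' by rewrite lt_min e0 divr_gt0.
have [N hN] : exists N, exp_coeff r N <= e'.
  have /cvgrPdist_le/(_ _ e'0) [N _ hN] := cvg_exp_coeff r.
  exists N; have := hN N (leqnn N); rewrite sub0r normrN ger0_norm//.
  by rewrite exp_coeff_ge0// ltW.
have hd x : `|x| <= r -> `|(- x) ^+ N / N`!%:R * cos (x + N.+1%:R * (pi / 2))| <= e'.
  move=> xr; apply: le_trans hN; rewrite /exp_coeff /=.
  rewrite normrM -[leRHS]mulr1 ler_pM ?cos_max//.
  rewrite normrM normrX normrN normfV normr_nat ler_wpM2r ?invr_ge0//.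
  by rewrite lerXn2r ?nnegrE// ltW.
exists N => x xr; split; last by rewrite (le_trans (hd x xr))// ge_min lexx.
have t0 : taylor N.+1 0 = 1 :> R.
  rewrite /taylor big_ord_recl big1 ?addr0 => [|i _].
    by rewrite expr0 fact0 divr1 !mul0r addr0 cos0 mul1r.
  by rewrite oppr0 lift0 expr0n/= !mul0r.
have c01 : continuous (taylor N.+1 : R -> R) by exact: continuous_taylor.
have [c cx cE] : exists2 c, `|c| <= r & taylor N.+1 x - 1 =
    ((- c) ^+ N / N`!%:R * cos (c + N.+1%:R * (pi / 2))) * x.
  move: xr; rewrite ler_norml => /andP[xr1 xr2].
  have [x0|x0] := leP 0 x.
    have [c] := MVT_segment x0 (fun z _ => is_derive_taylor N z) (continuous_subspaceT c01).
    rewrite in_itv/= => /andP[c1 c2]; rewrite t0 subr0 => cE.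
    by exists c => //; rewrite ler_norml; lra.
  have [c] := MVT_segment (ltW x0) (fun z _ => is_derive_taylor N z) (continuous_subspaceT c01).
  rewrite in_itv/= => /andP[c1 c2]; rewrite t0 sub0r => cE.
  by exists c; [rewrite ler_norml; lra|rewrite -opprB cE; ring].
rewrite cE normrM; apply: (@le_trans _ _ ((e / r) * r)); last by rewrite divfK// gt_eqF.
by apply: ler_pM => //; rewrite (le_trans (hd c cx))// ge_min lexx orbT.
Qed.

Lemma window_itv m (y : R) : `|y| <= 1 -> 0 <= (window R ^+ m).[y] <= 1.
Proof.
move=> y1; have : 0 <= (window R).[y] <= 1.
  rewrite /window hornerD hornerN hornerXn hornerC.
  have : y ^+ 2 <= 1 by rewrite -real_normK ?num_real// expr_le1.
  by have := sqr_ge0 y; lra.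
rewrite horner_exp => /andP[h0 h1]; apply/andP; split; first exact: exprn_ge0.
exact: exprn_ile1.
Qed.

Lemma window_near1 m : exists C : R, 0 <= C /\ forall y : R, `|y| <= 1 ->
  `|1 - (window R ^+ m).[y]| <= C * `|y|.
Proof.
have /factor_theorem [V VE] : root (1 - window R ^+ m) 0.
  rewrite /root hornerD hornerN horner_exp /window hornerD hornerN hornerXn.
  by rewrite hornerC expr0n/= subr0 expr1n subrr.
exists (poly_bound V); split; first exact: poly_bound_ge0.
move=> y y1.
have -> : 1 - (window R ^+ m).[y] = (1 - window R ^+ m).[y].
  by rewrite hornerD hornerN hornerC.
rewrite VE hornerM normrM hornerXsubC subr0 ler_wpM2r//.
exact: horner_le.
Qed.

Lemma C1_compl phi phi' : C1 phi phi' ->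
  C1 (fun x => 1 - phi x) (fun x => - phi' x).
Proof.
move=> [d c]; split=> x.
  have := is_deriveB (is_derive_cst (1 : R) x 1) (d x).
  by rewrite sub0r.
by apply: cvgN; exact: c.
Qed.

(** The bump is a wave of frequency 1 in the first variable, on a scale [t], and a
    plateau on a much larger scale [T] in the second one, which confines the second
    frequency near 0. *)
Definition plateau m T := cut T (fun x : R => (window R ^+ m).[x / T]).

Definition bump N m t T x : R := carrier N m t x.1 * plateau m T x.2.

Lemma tame_bump N m t T : 0 <= t -> t <= T -> tame T (bump N m t T).
Proof.
move=> t0 tT; apply: tame_prod.
  have [mc bc hc] := @carrier_tame R N m t; split=> // x Tx; apply: hc.
  exact: le_lt_trans tT Tx.
by apply: tame1_cut; exact: continuous_scaled.
Qed.

(** The difference between 1 and the bump on the square, split into two products so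
    that its power factorizes. *)
Definition correction r N m t T x : R :=
  cut r (fun y => 1 - taylor N y * (window R ^+ m).[y / t]) x.1 * cut r (fun=> 1) x.2
  + cut r (fun y => taylor N y * (window R ^+ m).[y / t]) x.1
  * cut r (fun y => 1 - (window R ^+ m).[y / T]) x.2.

Lemma correctionE r N m t T x : r <= t -> t <= T -> square r x ->
  bump N m t T x + correction r N m t T x = 1.
Proof.
move=> rt tT [h1 h2]; rewrite /bump /correction /carrier /plateau /cut.
by rewrite h1 h2 (le_trans h1 rt) (le_trans h2 (le_trans rt tT)); ring.
Qed.

(** The degree [N] of the Taylor expansion depends on the precision only: the order
    [m] of the window is free and can be adapted to [N] afterwards, before [t] and
    [T] become large. *)
Lemma correction_small r (e : R) : 0 < r -> 0 < e -> exists N, forall m,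
  exists t0, forall t T, t0 <= t -> t <= T ->
    tame r (correction r N.+1 m t T) /\
    forall u, power (correction r N.+1 m t T) u <= e * weight u.
Proof.
move=> r0 e0.
pose ka : R := 2 * ((2 * r) ^+ 2 + (2 + 2 * r) ^+ 2).
pose kb : R := 2 * ((2 * r * 1) ^+ 2 + (2 * 1 + 2 * r * 0) ^+ 2) +
  2 * ((2 * r * 2) ^+ 2 + (2 * 2 + 2 * r * 1) ^+ 2).
have ka0 : 0 < ka by rewrite /ka; nra.
have kb0 : 0 < kb by rewrite /kb; nra.
pose q := Num.min 1 (e / (2 * ka * kb)).
have kab0 : 0 < 2 * ka * kb by apply: mulr_gt0 => //; apply: mulr_gt0.
have q0 : 0 < q by rewrite lt_min ltr01 divr_gt0.
have q1 : q <= 1 by rewrite ge_min lexx.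
have q22 : 0 < q / 2 by rewrite divr_gt0.
have [N hN] := taylor_small r0 q22; exists N => m.
set W := window R ^+ m.
have [C [C0 hC]] := window_near1 m.
pose D := poly_bound W^`(); have D0 : 0 <= D by exact: poly_bound_ge0.
pose z := 4 * C * r / q + 4 * D / q.
have z1 : 0 <= 4 * C * r / q by rewrite divr_ge0 ?mulr_ge0// ltW.
have z2 : 0 <= 4 * D / q by rewrite divr_ge0 ?mulr_ge0// ltW.
exists (r + 1 + z) => t T t0t tT.
have tr : r <= t by rewrite /z in t0t; lra.
have t1 : 1 <= t by rewrite /z in t0t; lra.
have t0 : 0 < t by lra.
have T0 : 0 < T by lra.
have qt : 4 * C * r + 4 * D <= q * t.
  have : z <= t by lra.
  by rewrite /z -mulrDl ler_pdivrMr// (mulrC q).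
(* the bounds on the rescaled window are the same for [t] and for [T] *)
have wt (s : R) x : t <= s -> `|x| <= r ->
    [/\ 0 <= W.[x / s] <= 1, `|1 - W.[x / s]| <= q / 4 & `|s^-1 * W^`().[x / s]| <= q / 4].
  move=> ts xr; have s0 : 0 < s by lra.
  have y1 : `|x / s| <= 1 by rewrite scaled_le1//; lra.
  have qs : q * t <= q * s by rewrite ler_pM2l.
  split; first exact: window_itv.
    apply: le_trans (hC _ y1) _; rewrite normrM normfV (gtr0_norm s0) mulrA.
    rewrite ler_pdivrMr//; have : C * `|x| <= C * r by rewrite ler_wpM2l.
    by lra.
  rewrite normrM normfV (gtr0_norm s0) mulrC ler_pdivrMr//.
  have Cr0 : 0 <= C * r by rewrite mulr_ge0// ltW.
  apply: le_trans (horner_le _ y1) _; rewrite -/D; lra.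
have CW s : C1 (fun x => W.[x / s]) (fun x => s^-1 * W^`().[x / s]) := C1_scaled W s.
pose tay' x : R := (- x) ^+ N / N`!%:R * cos (x + N.+1%:R * (pi / 2)).
pose A x : R := taylor N.+1 x * W.[x / t].
pose A' x : R := taylor N.+1 x * (t^-1 * W^`().[x / t]) + W.[x / t] * tay' x.
have CA : C1 A A'.
  split=> x; first exact: is_deriveM (is_derive_taylor N x) ((CW t).1 x).
  apply: cvgD; apply: cvgM.
  - exact: continuous_taylor.
  - exact: (CW t).2.
  - exact: continuous_scaled.
  - have -> : tay' = (fun x : R => ((-1) ^+ N / N`!%:R *: 'X^N).[x] *
        cos (1 * x + N.+1%:R * (pi / 2))).
      apply/funext => y; rewrite /tay' hornerZ hornerXn (exprNn y N) mul1r; ring.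
    apply: cvgM; first exact: continuous_horner.
    exact: continuous_cos_affine.
have hA x : `|x| <= r -> [/\ `|1 - A x| <= q, `|A x| <= 2 & `|A' x| <= q].
  move=> xr; have [W01 W1 W'1] := wt t x (lexx t) xr; have [T1 T'1] := hN x xr.
  have tay2 : `|taylor N.+1 x| <= 2.
    by rewrite -[taylor _ _](subrK 1); apply: le_trans (ler_normD _ _) _; rewrite normr1; lra.
  have aA : `|1 - A x| <= q.
    have -> : 1 - A x = (1 - taylor N.+1 x) + taylor N.+1 x * (1 - W.[x / t]) by rewrite /A; ring.
    apply: le_trans (ler_normD _ _) _; rewrite normrM distrC.
    have : `|taylor N.+1 x| * `|1 - W.[x / t]| <= 2 * (q / 4) by apply: ler_pM.
    by lra.
  split=> //.
    rewrite -[A x](subKr 1); apply: le_trans (ler_normB _ _) _.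
    by rewrite normr1; lra.
  apply: le_trans (ler_normD _ _) _; rewrite !normrM.
  have : `|taylor N.+1 x| * `|t^-1 * W^`().[x / t]| <= 2 * (q / 4) by apply: ler_pM.
  rewrite normrM.
  have : `|W.[x / t]| * `|tay' x| <= 1 * (q / 2).
    by apply: ler_pM => //; rewrite ger0_norm; case/andP: W01.
  rewrite /tay' !normrM; lra.
have cst1 : C1 (fun=> 1 : R) (fun=> 0 : R).
  by split=> x; [exact: is_derive_cst|exact: cvg_cst].
have cA := derive_continuous CA.1.
have cA1 := derive_continuous (C1_compl CA).1.
have cB1 := derive_continuous (C1_compl (CW T)).1.
have c1 := derive_continuous cst1.1.
have tm1 : tame r (fun x => cut r (fun y => 1 - A y) x.1 * cut r (fun=> 1) x.2).
  by apply: tame_prod; apply: tame1_cut.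
have tm2 : tame r (fun x => cut r A x.1 * cut r (fun y => 1 - W.[y / T]) x.2).
  by apply: tame_prod; apply: tame1_cut.
split.
  have := tame_lin 1 1 tm1 tm2; congr (tame r _).
  by apply/funext => x; rewrite !mul1r.
move=> u; apply: le_trans (powerD_le u tm1 tm2) _.
rewrite (@power_prod _ r)//; try exact: tame1_cut.
rewrite (@power_prod _ r)//; try exact: tame1_cut.
have hk v phi phi' : C1 phi phi' -> (forall x, `|x| <= r -> `|phi x| <= q) ->
    (forall x, `|x| <= r -> `|phi' x| <= q) -> power1 (cut r phi) v <= (ka * q) * weight1 v.
  move=> Cp p1 p2; apply: le_trans (cut_power_le v r0 Cp p1 p2) _.
  rewrite ler_pM2r ?weight1_gt0//.
  have -> : 2 * ((2 * r * q) ^+ 2 + (2 * q + 2 * r * q) ^+ 2) = ka * q * q by rewrite /ka; ring.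
  by rewrite -[leRHS]mulr1 ler_wpM2l// mulr_ge0// ltW.
have p1 := hk u.1 _ _ (C1_compl CA) (fun x xr => let: And3 h _ _ := hA x xr in h)
  (fun x xr => let: And3 _ _ h := hA x xr in (ltac:(by rewrite normrN))).
have p2 : power1 (cut r (fun y => 1 - W.[y / T])) u.2 <= ka * q * weight1 u.2.
  apply: (hk _ _ _ (C1_compl (CW T))) => x xr; have [_ h1 h2] := wt T x tT xr.
    by lra.
  by rewrite normrN; lra.
have p3 : power1 (cut r A) u.1 <= (2 * ((2 * r * 2) ^+ 2 + (2 * 2 + 2 * r * 1) ^+ 2)) * weight1 u.1.
  apply: (cut_power_le _ r0 CA) => x xr; have [_ h1 h2] := hA x xr => //.
  exact: le_trans h2 q1.
have p4 : power1 (cut r (fun=> 1)) u.2 <=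
    (2 * ((2 * r * 1) ^+ 2 + (2 * 1 + 2 * r * 0) ^+ 2)) * weight1 u.2.
  by apply: (cut_power_le _ r0 cst1) => x _; rewrite ?normr1 ?normr0.
have pp a v : 0 <= power1 a v by rewrite addr_ge0 ?sqr_ge0.
have m1 := ler_pM (pp _ _) (pp _ _) p1 p4.
have m2 := ler_pM (pp _ _) (pp _ _) p3 p2.
apply: (@le_trans _ _ (2 * (ka * q * kb) * weight u)).
  have -> : 2 * (ka * q * kb) * weight u = 2 *
      (ka * q * weight1 u.1 * (2 * ((2 * r * 1) ^+ 2 + (2 * 1 + 2 * r * 0) ^+ 2) * weight1 u.2) +
       2 * ((2 * r * 2) ^+ 2 + (2 * 2 + 2 * r * 1) ^+ 2) * weight1 u.1 * (ka * q * weight1 u.2)).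
    by rewrite /weight /kb; ring.
  by rewrite (ler_pM2l (ltr0n _ 2)); exact: lerD m1 m2.
rewrite ler_pM2r ?weight_gt0//.
have : q <= e / (2 * ka * kb) by rewrite ge_min lexx orbT.
rewrite ler_pdivlMr//; apply: le_trans.
by have -> : 2 * (ka * q * kb) = q * (2 * ka * kb) by ring.
Qed.

End Bump.

(** * Concentration of the transform of a bump *)

Section BumpEstimate.
Variable R : realType.
Implicit Types (t r v T : R) (a b phi : R -> R) (P Q : {poly R}) (u : R * R).

Lemma power1_le a v (K : R) : (forall s, `|phase_int1 a v s| <= K) ->
  power1 a v <= 2 * K ^+ 2.
Proof.
move=> aK; have h s : phase_int1 a v s ^+ 2 <= K ^+ 2.
  have K0 : 0 <= K := le_trans (normr_ge0 _) (aK 0).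
  by rewrite -real_normK ?num_real// lerXn2r ?nnegrE.
by rewrite /power1; have := h 0; have := h (- (pi / 2)); lra.
Qed.

Lemma weighted_power1_le a v (K : R) :
  (forall s, `|phase_int1 a v s| <= K) ->
  (forall s, `|v| * `|phase_int1 a v s| <= K) ->
  power1 a v <= 4 * K ^+ 2 * weight1 v.
Proof.
move=> aK avK; apply: ler_weight1.
have h s : (1 + v ^+ 2) * phase_int1 a v s ^+ 2 <= 2 * K ^+ 2.
  have K0 : 0 <= K := le_trans (normr_ge0 _) (aK 0).
  rewrite mulrDl mul1r -exprMn.
  have -> : 2 * K ^+ 2 = K ^+ 2 + K ^+ 2 by ring.
  apply: lerD; rewrite -real_normK ?num_real// lerXn2r ?nnegrE//.
  by rewrite normrM.
by rewrite /power1 mulrDr; have := h 0; have := h (- (pi / 2)); lra.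
Qed.

Lemma power1_ge0 a v : 0 <= power1 a v.
Proof. by rewrite addr_ge0 ?sqr_ge0. Qed.

(** With [X = t ^+ N] the largest size reached by the monomials, the scale
    [T = X ^+ 12], the strip width [X ^- 9] and the order [m = 14 * N] are chosen so
    that every gain by decay beats every loss in height, with one factor [X] left:
    far from the frequencies [1] and [-1] by the decay of the carrier, at
    [`|u.2| > X ^- 9] by that of the plateau. *)
Lemma bump_power N (del : R) : (0 < N)%N -> 0 < del -> del <= 1 ->
  exists m (C : R), 0 <= C /\ forall t u, 1 <= t ->
    power (bump N m t ((t ^+ N) ^+ 12)) u <= C / t ^+ N * weight u \/
    [/\ `|u.1 - 1| < del \/ `|u.1 + 1| < del, `|u.2| <= (t ^+ N) ^- 9 &
      power (bump N m t ((t ^+ N) ^+ 12)) u <= C * (t ^+ N) ^+ 26].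
Proof.
move=> N0 del0 del1; exists (N * 14)%N; set m := (N * 14)%N.
have m1 : (14 <= m)%N by rewrite /m -{1}[14%N]mul1n leq_mul2r N0 orbT.
have [Ca [Ca0 hCa]] := @carrier_decay R N m.
have [|Cd [Cd0 hCd]] := @window_int_decay R m (window R ^+ m).
  by exists 1; rewrite mul1r.
pose Cb := Num.max Cd (2 * poly_bound (window R ^+ m)).
have Cb0 : 0 <= Cb by rewrite le_max Cd0.
have [Cb1 Cb2] : Cd <= Cb /\ 2 * poly_bound (window R ^+ m) <= Cb.
  by rewrite /Cb !le_max !lexx orbT.
(* [d + 1 <= k * d ^+ m] for all [d >= del] *)
pose k : R := (1 + del^-1) * (del ^+ m.-1)^-1.
have k0 : 0 <= k by rewrite mulr_ge0 ?invr_ge0 ?exprn_ge0 ?addr_ge0 ?invr_ge0 ?ltW.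
pose c1 := 4 * (k * Ca) ^+ 2 * (4 * Cb ^+ 2).
pose c2 := 4 * (2 * Ca) ^+ 2 * (4 * Cb ^+ 2).
have c10 : 0 <= c1.
  by apply: mulr_ge0; apply: mulr_ge0 => //; exact: sqr_ge0.
have c20 : 0 <= c2.
  by apply: mulr_ge0; apply: mulr_ge0 => //; exact: sqr_ge0.
exists (c1 + c2); split; first exact: addr_ge0.
move=> t u t1; set X := t ^+ N; set T := X ^+ 12.
have t0 : 0 < t by lra.
have X1 : 1 <= X by exact: exprn_ege1.
have X0 : 0 < X by lra.
have Xp i j : (i <= j)%N -> X ^+ i <= X ^+ j by move=> ij; exact: ler_weXn2l.
have T1 : 1 <= T by exact: exprn_ege1.
have T0 : 0 < T by lra.
have tri : `|u.1| <= `|u.1 - 1| + 1 /\ `|u.1| <= `|u.1 + 1| + 1.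
  split; first by have := ler_normD (u.1 - 1) 1; rewrite subrK normr1.
  by have := ler_normB (u.1 + 1) 1; rewrite addrK normr1.
have tmX : t ^+ m = X ^+ 14 by rewrite /m exprM.
rewrite /bump (@power_prod _ T); last 2 first.
- have tT : t <= T.
    by rewrite /T /X -exprM -{1}[t]expr1; apply: ler_weXn2l => //; rewrite muln_gt0 N0.
  have [mc bc hc] := @carrier_tame R N m t; split=> // x Tx; apply: hc.
  exact: le_lt_trans tT Tx.
- by apply: tame1_cut; exact: continuous_scaled.
have ha s : `|phase_int1 (carrier N m t) u.1 s| <= Ca * X.
  by have [] := hCa t u.1 s 0 t1 (lexx 0) (normr_ge0 _) (normr_ge0 _).
have hb s : `|phase_int1 (plateau m T) u.2 s| <= Cb * T.
  by apply: le_trans (window_int_le _ _ _ T0) _; rewrite ler_wpM2r// ltW.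
have hbm s : (T * `|u.2|) ^+ m * `|phase_int1 (plateau m T) u.2 s| <= Cb * T.
  have := hCd T u.2 s T0; rewrite normrM (gtr0_norm T0) => /le_trans; apply.
  by rewrite ler_wpM2r// ltW.
have [far1|/negP near1] := boolP ((del <= `|u.1 - 1|) && (del <= `|u.1 + 1|)).
  left; have {far1}[f1 f2] := andP far1.
  pose d := Num.min `|u.1 - 1| `|u.1 + 1|.
  have d0 : del <= d by rewrite le_min f1.
  have dd : 0 < d by lra.
  have ud : `|u.1| <= d + 1.
    by case: tri => h1 h2; rewrite -lerBlDr le_min !lerBlDr h1.
  have kd : d * del ^+ m.-1 <= d ^+ m.
    rewrite -[in leRHS](prednK (ltn_trans _ m1))// exprS ler_wpM2l ?(ltW dd)//.
    by rewrite lerXn2r ?nnegrE ?(ltW dd) ?(ltW del0).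
  have hda s : d * `|phase_int1 (carrier N m t) u.1 s| <= Ca / X ^+ 13 * (del ^+ m.-1)^-1.
    set p := `|_|; have [_ hh] := hCa t u.1 s d t1 (ltW dd)
      (ltac:(by rewrite ge_min lexx)) (ltac:(by rewrite ge_min lexx orbT)).
    rewrite ler_pdivlMr ?exprn_gt0// ler_pdivlMr ?exprn_gt0//.
    rewrite -(ler_pM2r X0); apply: le_trans hh; rewrite exprMn tmX -/p.
    have -> : d * p * del ^+ m.-1 * X ^+ 13 * X = (d * del ^+ m.-1) * (X ^+ 14 * p) by ring.
    have -> : X ^+ 14 * d ^+ m * p = d ^+ m * (X ^+ 14 * p) by ring.
    apply: ler_wpM2r kd; apply: mulr_ge0; last exact: normr_ge0.
    by apply: exprn_ge0; exact: ltW.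
  have q1 : power1 (carrier N m t) u.1 <= 4 * (k * Ca / X ^+ 13) ^+ 2 * weight1 u.1.
    have dk : d + 1 <= (1 + del^-1) * d.
      by rewrite mulrDl mul1r lerD2l -ler_pdivrMl ?invr_gt0// invrK mulr1.
    have hd s : (d + 1) * `|phase_int1 (carrier N m t) u.1 s| <= k * Ca / X ^+ 13.
      apply: (@le_trans _ _ ((1 + del^-1) * (d * `|phase_int1 (carrier N m t) u.1 s|))).
        by rewrite mulrA ler_wpM2r.
      have -> : k * Ca / X ^+ 13 = (1 + del^-1) * (Ca / X ^+ 13 * (del ^+ m.-1)^-1).
        by rewrite /k; ring.
      by apply: ler_wpM2l; [rewrite addr_ge0// invr_ge0 ltW|exact: hda].
    apply: weighted_power1_le => s; apply: le_trans (hd s).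
      by rewrite -[leLHS]mul1r ler_wpM2r//; lra.
    by rewrite ler_wpM2r.
  have q2 : power1 (plateau m T) u.2 <= 4 * (Cb * T) ^+ 2 * weight1 u.2.
    apply: weighted_power1_le => s //.
    have [u2|u2] := leP `|u.2| 1.
      by apply: le_trans (hb s); rewrite -[leRHS]mul1r ler_wpM2r.
    apply: le_trans (hbm s); rewrite ler_wpM2r//.
    have w1 : `|u.2| <= T * `|u.2| by rewrite -{1}[`|u.2|]mul1r ler_wpM2r.
    apply: le_trans w1 _; rewrite -{1}[T * _]expr1; apply: ler_weXn2l => //.
      by rewrite -[1]mulr1; apply: ler_pM => //; exact: ltW.
    exact: leq_trans m1.
  apply: le_trans (ler_pM (power1_ge0 _ _) (power1_ge0 _ _) q1 q2) _.
  have -> : 4 * (k * Ca / X ^+ 13) ^+ 2 * weight1 u.1 * (4 * (Cb * T) ^+ 2 * weight1 u.2)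
      = c1 / X ^+ 2 * weight u.
    by rewrite /c1 /weight /T; field; rewrite gt_eqF.
  rewrite ler_pM2r ?weight_gt0//.
  apply: ler_pM => //; first by rewrite invr_ge0 exprn_ge0// ltW.
    by rewrite lerDl.
  by rewrite lef_pV2 ?posrE ?exprn_gt0// -{1}[X]expr1 Xp.
have {}near1 : `|u.1 - 1| < del \/ `|u.1 + 1| < del.
  by move/negP : near1; rewrite negb_and -!ltNge => /orP.
have [u2|u2] := leP `|u.2| (X ^- 9).
  right; split=> //.
  have q1 := power1_le ha; have q2 := power1_le hb.
  apply: le_trans (ler_pM (power1_ge0 _ _) (power1_ge0 _ _) q1 q2) _.
  have -> : 2 * (Ca * X) ^+ 2 * (2 * (Cb * T) ^+ 2) = 4 * (Ca ^+ 2 * Cb ^+ 2) * X ^+ 26.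
    by rewrite /T; ring.
  have CC : 0 <= Ca ^+ 2 * Cb ^+ 2 by rewrite mulr_ge0 ?sqr_ge0.
  have c2E : c2 = 64 * (Ca ^+ 2 * Cb ^+ 2) by rewrite /c2; ring.
  apply: ler_wpM2r; first by apply: exprn_ge0; exact: ltW.
  by rewrite c2E; lra.
left.
pose w := T * `|u.2|.
have wX : X ^+ 3 <= w.
  have -> : X ^+ 3 = T * X ^- 9 by rewrite /T; field; rewrite gt_eqF.
  by rewrite ler_wpM2l// ltW.
have w1 : 1 <= w by apply: le_trans wX; exact: exprn_ege1.
have w0 : 0 < w by lra.
have q1 : power1 (carrier N m t) u.1 <= 4 * (2 * Ca * X) ^+ 2 * weight1 u.1.
  have u12 : `|u.1| <= 2.
    by case: near1 => h; have := tri; move=> [h1 h2]; lra.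
  have CX : 0 <= Ca * X by rewrite mulr_ge0// ltW.
  apply: weighted_power1_le => s.
    by apply: le_trans (ha s) _; rewrite -mulrA; lra.
  by rewrite -mulrA; apply: ler_pM.
have q2 : power1 (plateau m T) u.2 <= 4 * (Cb / X ^+ 3) ^+ 2 * weight1 u.2.
  have hw s : w * `|phase_int1 (plateau m T) u.2 s| <= Cb / X ^+ 3.
    rewrite ler_pdivlMr ?exprn_gt0//.
    have T0' : 0 < X ^+ 12 by rewrite exprn_gt0.
    rewrite -(ler_pM2r T0'); apply: le_trans (hbm s); rewrite -/w.
    set p := `|_|.
    have -> : w * p * X ^+ 3 * X ^+ 12 = (w * (X ^+ 3) ^+ 5) * p by ring.
    apply: ler_wpM2r; first exact: normr_ge0.
    apply: (@le_trans _ _ (w ^+ 6)).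
      rewrite (exprS w 5) ler_wpM2l ?(ltW w0)// lerXn2r ?nnegrE ?(ltW w0)//.
      by rewrite ltW// exprn_gt0.
    by apply: ler_weXn2l => //; exact: leq_trans m1.
  apply: weighted_power1_le => s; apply: le_trans (hw s); rewrite ?ler_wpM2r//.
    by rewrite -[leLHS]mul1r ler_wpM2r.
  by rewrite /w -{1}[`|u.2|]mul1r ler_wpM2r.
apply: le_trans (ler_pM (power1_ge0 _ _) (power1_ge0 _ _) q1 q2) _.
have -> : 4 * (2 * Ca * X) ^+ 2 * weight1 u.1 * (4 * (Cb / X ^+ 3) ^+ 2 * weight1 u.2)
    = c2 / X ^+ 4 * weight u.
  by rewrite /c2 /weight; field; rewrite gt_eqF.
rewrite ler_pM2r ?weight_gt0//.
apply: ler_pM => //; first by rewrite invr_ge0 exprn_ge0// ltW.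
  by rewrite lerDr.
by rewrite lef_pV2 ?posrE ?exprn_gt0// -{1}[X]expr1 Xp.
Qed.

End BumpEstimate.

(** * Trigonometric approximation of Borel sets *)

Section Trig.
Variables (R : realType) (om : R).
Hypothesis om0 : 0 < om.
Implicit Types (u v : R * R) (p q : R * R -> R) (z : int * int).

Definition freq z : R * R := (om * z.1%:~R, om * z.2%:~R).

Definition wave z (t : R) u : R := cos (plane_dot (freq z) u + t).

(** Real trigonometric polynomials with frequencies in a lattice; the phase makes
    sines superfluous, and [adm] restricts the frequencies. *)
Inductive trig (adm : int * int -> Prop) : (R * R -> R) -> Prop :=
| trig_wave z t : adm z -> trig adm (wave z t)
| trig_lin a b p q : trig adm p -> trig adm q ->
    trig adm (fun u => a * p u + b * q u).

Definition allfreq z := True.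

Lemma trig_eq adm p q : trig adm p -> p =1 q -> trig adm q.
Proof. by move=> tp /funext <-. Qed.

Lemma trig_cst (c : R) : trig allfreq (fun=> c).
Proof.
have w : trig allfreq (wave (0, 0) 0) by exact: trig_wave.
apply: trig_eq (trig_lin c 0 w w) _ => u.
by rewrite /wave /plane_dot /= !mulr0 !mul0r !addr0 cos0 mulr1.
Qed.

Lemma trigD p q : trig allfreq p -> trig allfreq q -> trig allfreq (fun u => p u + q u).
Proof.
by move=> tp tq; apply: trig_eq (trig_lin 1 1 tp tq) _ => u; rewrite !mul1r.
Qed.

Lemma trigB p q : trig allfreq p -> trig allfreq q -> trig allfreq (fun u => p u - q u).
Proof.
by move=> tp tq; apply: trig_eq (trig_lin 1 (-1) tp tq) _ => u; rewrite mul1r mulN1r.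
Qed.

Lemma trigZ (a : R) p : trig allfreq p -> trig allfreq (fun u => a * p u).
Proof.
by move=> tp; apply: trig_eq (trig_lin a 0 tp tp) _ => u; rewrite mul0r addr0.
Qed.

Lemma cosM_sum (a b : R) : cos a * cos b = 2^-1 * cos (a + b) + 2^-1 * cos (a - b).
Proof. by rewrite cosD cosB; field. Qed.

Lemma waveM z w s t u : wave z s u * wave w t u =
  2^-1 * wave (z + w) (s + t) u + 2^-1 * wave (z - w) (s - t) u.
Proof.
rewrite /wave.
have -> : plane_dot (freq (z + w)) u + (s + t) =
    (plane_dot (freq z) u + s) + (plane_dot (freq w) u + t).
  by rewrite /plane_dot /freq /= !intrD; ring.
have -> : plane_dot (freq (z - w)) u + (s - t) =
    (plane_dot (freq z) u + s) - (plane_dot (freq w) u + t).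
  by rewrite /plane_dot /freq /= !intrB; ring.
exact: cosM_sum.
Qed.

Lemma trigM p q : trig allfreq p -> trig allfreq q -> trig allfreq (fun u => p u * q u).
Proof.
move=> tp tq; elim: tp => [z s _|a b p1 p2 _ h1 _ h2]; last first.
  by apply: trig_eq (trig_lin a b h1 h2) _ => u; ring.
elim: tq => [w t _|a b q1 q2 _ h1 _ h2]; last first.
  by apply: trig_eq (trig_lin a b h1 h2) _ => u; ring.
have h1 : trig allfreq (wave (z + w) (s + t)) by exact: trig_wave.
have h2 : trig allfreq (wave (z - w) (s - t)) by exact: trig_wave.
by apply: trig_eq (trig_lin 2^-1 2^-1 h1 h2) _ => u; rewrite waveM.
Qed.

Lemma trigX p n : trig allfreq p -> trig allfreq (fun u => p u ^+ n).
Proof.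
move=> tp; elim: n => [|n IH].
  by apply: trig_eq (trig_cst 1) _ => u; rewrite expr0.
by apply: trig_eq (trigM tp IH) _ => u; rewrite exprS.
Qed.

Lemma measurable_wave z t : measurable_fun [set: borel2 R] (wave z t).
Proof. exact: measurable_cos_dot. Qed.

Lemma measurable_trig adm p : trig adm p -> measurable_fun [set: borel2 R] p.
Proof.
elim=> [z t _|a b p1 p2 _ h1 _ h2]; first exact: measurable_wave.
by apply: measurable_funD; apply: measurable_funM.
Qed.

Lemma trig_bounded adm p : trig adm p -> exists K : R, 0 < K /\ forall u, `|p u| <= K.
Proof.
elim=> [z t _|a b p1 p2 _ [K [K0 h1]] _ [L [L0 h2]]].
  by exists 1; split=> // u; exact: cos_max.
exists (`|a| * K + `|b| * L + 1); split.
  by rewrite ltr_wpDl// addr_ge0// mulr_ge0// ltW.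
move=> u; apply: le_trans (ler_normD _ _) _; rewrite !normrM.
rewrite ler_wpDr// lerD// ler_wpM2l//.
Qed.

(** The functions in [trig] have period [2 * half_period] in each variable. *)
Definition half_period : R := pi / om.
Definition cell : set (borel2 R) :=
  [set u | `|u.1| < half_period /\ `|u.2| < half_period].

Lemma cellN u : cell u -> cell (- u).
Proof. by case: u => a b [/= h1 h2]; split; rewrite /= normrN. Qed.

Lemma cellE : cell =
  `]- half_period, half_period[%classic `*` `]- half_period, half_period[%classic.
Proof.
by apply/seteqP; split=> -[a b] /=; rewrite !in_itv/= -!ltr_norml.
Qed.

Lemma measurable_cell : measurable cell.
Proof. by rewrite cellE; apply: measurableX. Qed.

Section Approximation.
Variable nu : {measure set (borel2 R) -> \bar R}.
Hypothesis nu_fin : (nu cell < +oo)%E.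

(** Evaluating the error at [u] and at [- u] controls the even part of the
    approximating polynomial too; only even multipliers preserve real functions. *)
Definition err p (B : set (borel2 R)) u : R :=
  `|p u - \1_B u| + `|p (- u) - \1_B (- u)|.

(** These sets form a sigma-algebra: complements and intersections because [1 - q] and
    [p * q] are again polynomials with values between 0 and 1, unions by dominated
    convergence. *)
Definition approximable (B : set (borel2 R)) := measurable B /\
  forall e : R, 0 < e -> exists q, [/\ trig allfreq q,
    forall u, 0 <= q u <= 1 & (\int[nu]_(u in cell) (err q B u)%:E < e%:E)%E].

Lemma measurable_opp2 : measurable_fun [set: borel2 R] (fun u : borel2 R => - u).
Proof.
have := @measurable_plane_iso R true 0; congr (measurable_fun _ _).
by apply/funext => -[a b]; rewrite /plane_iso /line_iso expr1 /= !mulN1r !addr0.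
Qed.

Lemma measurable_err p B : measurable_fun [set: borel2 R] p -> measurable B ->
  measurable_fun [set: borel2 R] (err p B).
Proof.
move=> mp mB.
have h : measurable_fun [set: borel2 R] (fun u => `|p u - \1_B u|).
  by apply: measurableT_comp => //; apply: measurable_funB.
apply: measurable_funD => //.
exact: (measurableT_comp h measurable_opp2).
Qed.

Lemma err_ge0 p B u : 0 <= err p B u.
Proof. by rewrite addr_ge0. Qed.

(** Bounded pointwise convergence on the cell suffices, [nu] being finite there. *)
Lemma err_cvg (f : nat -> R * R -> R) B :
  (forall n, measurable_fun [set: borel2 R] (f n)) -> measurable B ->
  (forall n u, 0 <= f n u <= 1) ->
  (forall u, cell u -> f ^~ u @ \oo --> (\1_B u : R)) ->
  forall e : R, 0 < e -> exists n, (\int[nu]_(u in cell) (err (f n) B u)%:E < e%:E)%E.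
Proof.
move=> mf mB f01 fB e e0.
have i1 (u : borel2 R) : 0 <= (\1_B u : R) <= 1.
  by rewrite indicE; case: (u \in B); rewrite /= ?lexx ?ler01.
have b2 n u : `|err (f n) B u| <= 2.
  rewrite (ger0_norm (err_ge0 _ _ _)) /err.
  have h (x y : R) : 0 <= x <= 1 -> 0 <= y <= 1 -> `|x - y| <= 1.
    by move=> /andP[? ?] /andP[? ?]; rewrite ler_norml; apply/andP; split; lra.
  have -> : 2 = 1 + 1 :> R by [].
  by apply: lerD; apply: h.
have := @dominated_convergence _ _ R nu _ measurable_cell
  (fun n u => (err (f n) B u)%:E) (cst 0%E) (cst 2%:E).
case.
- by move=> n; apply/measurable_EFinP; apply: measurable_funTS; exact: measurable_err.
- exact: measurable_cst.
- apply: aeW => u cu; apply/fine_cvgP; split; first exact: nearW.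
  rewrite /= (_ : 0 = `|\1_B u - \1_B u| + `|\1_B (- u) - \1_B (- u)| :> R); last first.
    by rewrite !subrr normr0 addr0.
  have c (w : R * R) : cell w -> `|f n w - \1_B w| @[n --> \oo] --> (`|\1_B w - \1_B w| : R).
    by move=> cw; apply: cvg_norm; apply: cvgB; [exact: fB|exact: cvg_cst].
  by apply: cvgD; apply: c => //; exact: cellN.
- apply/integrableP; split; first exact: measurable_cst.
  rewrite (eq_integral (cst 2%:E)); last by move=> u _ /=; rewrite ger0_norm.
  rewrite integral_cst; last exact: measurable_cell.
  by apply: lte_mul_pinfty; rewrite ?lee_fin.
- by apply: aeW => u cu n /=; rewrite lee_fin.
move=> _ _; rewrite integral0 => /fine_cvgP[fin cv].
have cve := cvgr_lt _ cv _ e0.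
near \oo => n; exists n.
have finn : (\int[nu]_(u in cell) (err (f n) B u)%:E)%E \is a fin_num.
  by near: n; exact: fin.
by rewrite -(fineK finn) lte_fin; near: n; exact: cve.
Unshelve. all: by end_near.
Qed.

Lemma approximable_lim (f : nat -> R * R -> R) B :
  (forall n, trig allfreq (f n)) -> measurable B ->
  (forall n u, 0 <= f n u <= 1) ->
  (forall u, cell u -> f ^~ u @ \oo --> (\1_B u : R)) -> approximable B.
Proof.
move=> tf mB f01 fB; split=> // e e0.
have [n hn] := err_cvg (fun n => measurable_trig (tf n)) mB f01 fB e0.
by exists (f n).
Qed.

Lemma indic01 (B : set (borel2 R)) u : 0 <= (\1_B u : R) <= 1.
Proof. by rewrite indicE; case: (u \in B); rewrite /= ?lexx ?ler01. Qed.

Lemma err_le_integral p q1 q2 B C1 C2 : measurable_fun [set: borel2 R] p ->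
  measurable_fun [set: borel2 R] q1 -> measurable_fun [set: borel2 R] q2 ->
  measurable B -> measurable C1 -> measurable C2 ->
  (forall w, `|p w - \1_B w| <= `|q1 w - \1_C1 w| + `|q2 w - \1_C2 w|) ->
  (\int[nu]_(u in cell) (err p B u)%:E <=
   \int[nu]_(u in cell) (err q1 C1 u)%:E + \int[nu]_(u in cell) (err q2 C2 u)%:E)%E.
Proof.
move=> mp mq1 mq2 mB mC1 mC2 h.
have me q C : measurable_fun [set: borel2 R] q -> measurable C ->
    measurable_fun cell (fun u => (err q C u)%:E).
  by move=> mq mC; apply/measurable_EFinP; apply: measurable_funTS; exact: measurable_err.
rewrite -ge0_integralD//; try exact: me; try exact: measurable_cell;
  try by move=> u _; rewrite lee_fin err_ge0.
apply: ge0_le_integral => //; first exact: measurable_cell.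
- by move=> u _; rewrite lee_fin err_ge0.
- exact: me.
- by apply: emeasurable_funD; exact: me.
- by move=> u _; rewrite -EFinD lee_fin /err; have := h u; have := h (- u); lra.
Qed.

Lemma approximable_cvg (C : nat -> set (borel2 R)) B :
  (forall n, approximable (C n)) -> measurable B ->
  (forall u, cell u -> (fun n => \1_(C n) u : R) @ \oo --> (\1_B u : R)) -> approximable B.
Proof.
move=> aC mB CB; split=> // e e0.
have e20 : 0 < e / 2 by rewrite divr_gt0.
have mC n : measurable (C n) by have [] := aC n.
have mi (D : set (borel2 R)) : measurable D -> measurable_fun [set: borel2 R] (\1_D : _ -> R).
  by move=> mD; exact: measurable_indic.
have [n hn] := err_cvg (fun n => mi _ (mC n)) mB (fun n => indic01 (C n)) CB e20.
have [q [tq q01 qe]] := (aC n).2 _ e20.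
exists q; split=> //.
apply: le_lt_trans (err_le_integral (measurable_trig tq) (measurable_trig tq)
  (mi _ (mC n)) mB (mC n) mB _) _.
  move=> w; apply: le_trans (ler_normD _ _).
  by rewrite addrA subrK.
by rewrite [e]splitr EFinD lteD.
Qed.

Lemma approximableC B : approximable B -> approximable (~` B).
Proof.
move=> [mB aB]; split=> [|e e0]; first exact: measurableC.
have [q [tq q01 qe]] := aB e e0.
exists (fun u => 1 - q u); split.
- by apply: trigB => //; exact: trig_cst.
- by move=> u; have /andP[? ?] := q01 u; apply/andP; split; lra.
- have h w : `|1 - q w - \1_(~` B) w| = `|q w - \1_B w|.
    rewrite !indicE in_setC; case: (w \in B) => /=.
      by rewrite -normrN; congr `|_|; ring.
    by rewrite -normrN; congr `|_|; ring.
  have -> : err (fun u => 1 - q u) (~` B) = err q B.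
    by apply/funext => u; rewrite /err !h.
  exact: qe.
Qed.

Lemma approximableI B C : approximable B -> approximable C -> approximable (B `&` C).
Proof.
move=> [mB aB] [mC aC]; split=> [|e e0]; first exact: measurableI.
have e20 : 0 < e / 2 by rewrite divr_gt0.
have [p [tp p01 pe]] := aB _ e20.
have [q [tq q01 qe]] := aC _ e20.
exists (fun u => p u * q u); split.
- exact: trigM.
- move=> u; have /andP[? ?] := p01 u; have /andP[? ?] := q01 u.
  by rewrite mulr_ge0//= mulr_ile1.
- apply: le_lt_trans (err_le_integral (measurable_trig (trigM tp tq))
    (measurable_trig tp) (measurable_trig tq)
    (measurableI _ _ mB mC) mB mC _) _; last by rewrite [e]splitr EFinD lteD.
  move=> w; rewrite indicI /=.
  have -> : p w * q w - \1_B w * \1_C w = (p w - \1_B w) * q w + \1_B w * (q w - \1_C w) by ring.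
  apply: le_trans (ler_normD _ _) _; rewrite !normrM; apply: lerD.
    have /andP[q0 q1] := q01 w.
    by rewrite (ger0_norm q0) -[leRHS]mulr1 ler_wpM2l.
  have /andP[q0 q1] := indic01 B w.
  by rewrite (ger0_norm q0) -[leRHS]mul1r ler_wpM2r.
Qed.

Lemma approximable0 : approximable set0.
Proof.
split=> // e e0; exists (fun=> 0); split; first exact: trig_cst.
- by move=> u; rewrite lexx ler01.
- rewrite integral0_eq ?lte_fin// => u _.
  by rewrite /err !indicE !in_set0 subrr normr0 addr0.
Qed.

Lemma approximableU B C : approximable B -> approximable C -> approximable (B `|` C).
Proof.
move=> aB aC; rewrite -[B `|` C]setCK setCU.
by apply/approximableC/approximableI; exact: approximableC.
Qed.

Lemma approximable_bigcup (C : nat -> set (borel2 R)) :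
  (forall n, approximable (C n)) -> approximable (\bigcup_n C n).
Proof.
move=> aC.
have aU n : approximable (\bigcup_(i in `I_n) C i).
  elim: n => [|n IH]; first by rewrite II0 bigcup_set0; exact: approximable0.
  by rewrite IIS bigcup_setU bigcup_set1; exact: approximableU.
apply: (approximable_cvg aU).
  by apply: bigcup_measurable => n _; have [] := aC n.
move=> u _; have [[n _ un]|nu'] := pselect ((\bigcup_n C n) u); last first.
  rewrite indicE memNset//.
  rewrite (_ : (fun n => _) = fun=> 0); first exact: cvg_cst.
  apply/funext => n; rewrite indicE memNset// => -[i _ ui]; apply: nu'.
  by exists i.
rewrite indicE mem_set; last by exists n.
apply: cvg_near_cst; exists n.+1 => // k /= nk.
by rewrite indicE mem_set//; exists n.
Qed.

Lemma bernoulli_le (y : R) k : -1 <= y -> 1 + k%:R * y <= (1 + y) ^+ k.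
Proof.
move=> y1; elim: k => [|k IH]; first by rewrite mul0r addr0 expr0.
rewrite exprS; apply: (@le_trans _ _ ((1 + y) * (1 + k%:R * y))); last first.
  by rewrite ler_wpM2l//; lra.
have -> : k.+1%:R = k%:R + 1 :> R by rewrite -natr1.
have : 0 <= k%:R * (y * y) by rewrite mulr_ge0// -expr2 sqr_ge0.
by lra.
Qed.

(** The usual soft threshold at [1 / 2]: bounded by Bernoulli's inequality on
    both sides. *)
Lemma threshold_cvg (x : R) : 0 <= x <= 1 ->
  (x < 2^-1 -> 1 - (1 - x ^+ n) ^+ (2 ^ n) @[n --> \oo] --> (0 : R)) /\
  (2^-1 < x -> (1 - x ^+ n) ^+ (2 ^ n) @[n --> \oo] --> (0 : R)).
Proof.
move=> /andP[x0 x1].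
have xn01 n : 0 <= x ^+ n <= 1 by rewrite exprn_ge0//= exprn_ile1.
have p01 n : 0 <= (1 - x ^+ n) ^+ (2 ^ n) <= 1.
  have /andP[? ?] := xn01 n.
  by rewrite exprn_ge0 ?exprn_ile1//; lra.
split=> hx.
  apply: (@squeeze_cvgr _ _ _ _ (fun=> 0) (fun n => (2 * x) ^+ n)).
  - apply: nearW => n; have /andP[? ?] := p01 n; apply/andP; split; first lra.
    have /andP[? ?] := xn01 n.
    have := @bernoulli_le (- x ^+ n) (2 ^ n).
    by rewrite exprMn natrX => /(_ _)/wrap[|h]; lra.
  - exact: cvg_cst.
  - by apply: cvg_expr; rewrite ger0_norm; lra.
apply: (@squeeze_cvgr _ _ _ _ (fun=> 0) (fun n => ((2 * x)^-1) ^+ n)).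
- apply: nearW => n; have /andP[p0 p1] := p01 n; rewrite p0 /=.
  have /andP[xn0 xn1] := xn01 n.
  have X0 : 0 < (2 * x) ^+ n by rewrite exprn_gt0//; lra.
  rewrite exprVn -[leRHS]mul1r ler_pdivlMr//.
  have b : (2 * x) ^+ n <= (1 + x ^+ n) ^+ (2 ^ n).
    rewrite exprMn -natrX; apply: le_trans (bernoulli_le _ _); lra.
  apply: (@le_trans _ _ ((1 - x ^+ n) ^+ (2 ^ n) * (1 + x ^+ n) ^+ (2 ^ n))).
    by rewrite ler_wpM2l.
  rewrite -exprMn; apply: exprn_ile1.
    by rewrite mulr_ge0; lra.
  have := sqr_ge0 (x ^+ n); rewrite expr2; lra.
- exact: cvg_cst.
- apply: cvg_expr; rewrite ger0_norm ?invr_ge0; last lra.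
  by rewrite invf_lt1; lra.
Qed.

(** The second factor removes the level set [f = 0], where the soft threshold does not
    converge to 0 or 1. *)
Lemma approximable_pos f : trig allfreq f -> approximable [set u | 0 < f u].
Proof.
move=> tf; have [K [K0 fK]] := trig_bounded tf.
(* [g] has values between 0 and 1, and [f u > 0] means [g u > 1 / 2] *)
pose h u := K^-1 * f u; pose g u := 2^-1 * (1 + h u).
have th : trig allfreq h by exact: trigZ.
have tg : trig allfreq g by apply: trigZ; apply: trigD => //; exact: trig_cst.
have h1 u : -1 <= h u <= 1.
  rewrite -ler_norml /h normrM ger0_norm ?invr_ge0 ?(ltW K0)//.
  by rewrite ler_pdivrMl// mulr1.
have g01 u : 0 <= g u <= 1.
  by have /andP[? ?] := h1 u; rewrite /g; apply/andP; split; lra.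
have h201 u : 0 <= 1 - h u ^+ 2 <= 1.
  have : h u ^+ 2 <= 1 by rewrite -real_normK ?num_real// expr_le1// ler_norml.
  by have := sqr_ge0 (h u) => ? ?; apply/andP; split; lra.
pose F n u := (1 - (1 - g u ^+ n) ^+ (2 ^ n)) * (1 - (1 - h u ^+ 2) ^+ n).
have mpos : measurable [set u : borel2 R | 0 < f u].
  rewrite -[X in measurable X]setTI.
  have -> : [set u : borel2 R | 0 < f u] = f @^-1` `]0, +oo[%classic.
    by apply/seteqP; split=> u /=; rewrite in_itv/= andbT.
  by apply: (measurable_trig tf) => //; exact: measurable_itv.
have one01 (x : R) : 0 <= x <= 1 -> 0 <= 1 - x <= 1.
  by move=> /andP[? ?]; apply/andP; split; lra.
have pow01 (x : R) k : 0 <= x <= 1 -> 0 <= x ^+ k <= 1.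
  by move=> /andP[? ?]; rewrite exprn_ge0//= exprn_ile1.
have F01 n u : 0 <= F n u <= 1.
  have /andP[a0 a1] := one01 _ (pow01 _ (2 ^ n)%N (one01 _ (pow01 _ n (g01 u)))).
  have /andP[b0 b1] := one01 _ (pow01 _ n (h201 u)).
  by rewrite /F mulr_ge0//= mulr_ile1.
apply: (@approximable_lim F) => // [n|u _].
  apply: trigM; apply: trigB; try exact: trig_cst; apply: trigX.
    by apply: trigB; [exact: trig_cst|exact: trigX].
  by apply: trigB; [exact: trig_cst|exact: trigX].
have [c1 c2] := threshold_cvg (g01 u).
have hsgn : f u = K * h u by rewrite /h mulrA divff ?mul1r// gt_eqF.
have [f0|f0|f0] := ltgtP 0 (f u).
- rewrite indicE mem_set//=.
  have h0 : 0 < h u by rewrite /h mulr_gt0// invr_gt0.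
  have /andP[h20 h21] := h201 u.
  have -> : true%:R = (1 - 0) * (1 - 0) :> R by rewrite !subr0 mulr1.
  apply: cvgM; apply: cvgB; try exact: cvg_cst.
    by apply: c2; rewrite /g; lra.
  have h20' : 0 < h u ^+ 2 by exact: exprn_gt0.
  by apply: cvg_expr; rewrite ger0_norm//; lra.
- have h0 : h u < 0 by rewrite /h pmulr_rlt0 ?invr_gt0.
  rewrite indicE memNset/=; last by move=> /=; rewrite ltNge ltW.
  apply: (@squeeze_cvgr _ _ _ _ (fun=> 0) (fun n => 1 - (1 - g u ^+ n) ^+ (2 ^ n))).
  - apply: nearW => n; have /andP[F0 F1] := F01 n u; rewrite F0 /=.
    have /andP[a0 a1] := one01 _ (pow01 _ (2 ^ n)%N (one01 _ (pow01 _ n (g01 u)))).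
    have /andP[b0 b1] := one01 _ (pow01 _ n (h201 u)).
    by rewrite /F -[leRHS]mulr1 ler_wpM2l.
  - exact: cvg_cst.
  - by apply: c1; rewrite /g; lra.
- rewrite indicE memNset/=; last by rewrite /= -f0 ltxx.
  rewrite (_ : (fun n => _) = fun=> 0); first exact: cvg_cst.
  apply/funext => n; rewrite /F /h -f0 mulr0 expr0n subr0 expr1n subrr mulr0.
  by [].
Qed.

Lemma approximable_eq B C : approximable B -> measurable C ->
  (forall u, cell u -> B u <-> C u) -> approximable C.
Proof.
move=> aB mC BC; apply: (@approximable_cvg (fun=> B)) => // u cu.
have -> : \1_C u = \1_B u :> R; last exact: cvg_cst.
have [BCu CBu] := BC u cu; rewrite !indicE; have [uB|uB] := pselect (B u).
  by rewrite !mem_set//; exact: BCu.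
by rewrite !memNset// => /CBu.
Qed.

Lemma approximableT : approximable setT.
Proof. by rewrite -setC0; exact/approximableC/approximable0. Qed.

Lemma ltr_angle_pos (al x : R) : 0 <= al < pi -> - pi < x < pi ->
  (al < x) = (0 < sin x) && (cos x < cos al).
Proof.
move=> /andP[a0 api] /andP[xNpi xpi].
have [x0|x0] := ltP 0 x.
  have sx : 0 < sin x by apply: sin_gt0_pi; rewrite x0.
  by rewrite sx /= ltr_cos// in_itv/=; lra.
have -> : (al < x) = false by apply/negbTE; rewrite -leNgt; lra.
have : 0 <= sin (- x) by apply: sin_ge0_pi; lra.
by rewrite sinN; case: (ltP 0 (sin x)) => //= ? ?; lra.
Qed.

Lemma ltr_angle_neg (al x : R) : - pi < al < 0 -> - pi < x < pi ->
  (al < x) = ~~ ((0 < - sin x) && (cos x <= cos al)).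
Proof.
move=> /andP[aNpi a0] /andP[xNpi xpi]; rewrite ltNge; congr negb.
have [x0|x0] := ltP 0 (- x).
  have sx : 0 < sin (- x) by apply: sin_gt0_pi; lra.
  rewrite -sinN sx /= -(cosN x) -(cosN al) -lerN2 !leNgt; congr negb.
  by rewrite ltr_cos// in_itv/=; lra.
have -> : (x <= al) = false by apply/negbTE; rewrite -ltNge; lra.
have : 0 <= sin x by apply: sin_ge0_pi; lra.
by case: (ltP 0 (- sin x)) => //= ? ?; lra.
Qed.

(** Inside a cell a coordinate is determined by its sine and cosine, which are
    trigonometric polynomials. *)
Lemma approximable_ray z (X : R * R -> R) (a : R) :
  measurable_fun [set: borel2 R] X ->
  (forall u, plane_dot (freq z) u = om * X u) ->
  (forall u, cell u -> `|X u| < half_period) ->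
  approximable [set u | a < X u].
Proof.
move=> mX zX cX.
have mray : measurable [set u : borel2 R | a < X u].
  rewrite -[X in measurable X]setTI.
  have -> : [set u : borel2 R | a < X u] = X @^-1` `]a, +oo[%classic.
    by apply/seteqP; split=> u /=; rewrite in_itv/= andbT.
  by apply: mX => //; exact: measurable_itv.
have pi0 := pi_gt0 R.
have L0 : 0 < half_period by rewrite divr_gt0.
have cL u : cell u -> - pi < om * X u < pi.
  move=> /cX; rewrite ltr_norml /half_period => /andP[].
  rewrite ltr_pdivlMr// -mulNr ltr_pdivrMr// mulrC => -> .
  by rewrite mulrC => ->.
have wc u t : wave z t u = cos (om * X u + t) by rewrite /wave zX.
have tc : trig allfreq (fun u => cos (om * X u)).
  apply: (@trig_eq _ (wave z 0)); first exact: trig_wave.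
  by move=> u; rewrite wc addr0.
have ts : trig allfreq (fun u => sin (om * X u)).
  apply: (@trig_eq _ (wave z (- (pi / 2)))); first exact: trig_wave.
  by move=> u; rewrite wc cosBpihalf.
have [aL|aL] := leP half_period a.
  apply: approximable_eq approximable0 mray _ => u /cX; rewrite ltr_norml => /andP[_ h].
  by split => //= ?; lra.
have [aNL|aNL] := leP a (- half_period).
  apply: approximable_eq approximableT mray _ => u /cX; rewrite ltr_norml => /andP[h _].
  by split => //= _; lra.
have aX u : (a < X u) = (om * a < om * X u) by rewrite ltr_pM2l.
have api : - pi < om * a < pi.
  have LE : half_period * om = pi by rewrite /half_period divfK// gt_eqF.
  by rewrite mulrC -LE -mulNr !ltr_pM2r// aNL aL.
case/andP: api => api1 api2.
have [a0|a0] := leP 0 a.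
  have al0 : 0 <= om * a < pi by rewrite api2 andbT mulr_ge0// ltW.
  have h := approximableI (approximable_pos ts)
    (approximable_pos (trigB (trig_cst (cos (om * a))) tc)).
  apply: approximable_eq h mray _ => u cu /=.
  rewrite aX (ltr_angle_pos al0 (cL u cu)) subr_gt0.
  by split => [[-> ->]|/andP[]].
have al0 : - pi < om * a < 0 by rewrite api1 pmulr_rlt0.
have tNs : trig allfreq (fun u => - sin (om * X u)).
  by apply: trig_eq (trigZ (-1) ts) _ => u; rewrite mulN1r.
have h := approximableC (approximableI (approximable_pos tNs)
    (approximableC (approximable_pos (trigB tc (trig_cst (cos (om * a))))))).
apply: approximable_eq h mray _ => u cu /=.
rewrite aX (ltr_angle_neg al0 (cL u cu)) subr_gt0 leNgt.
by split => [h1|/negP h1 [h2 h3]]; [apply/negP => /andP[h2 /negP h3]; exact: h1|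
  apply: h1; rewrite h2; exact/negP].
Qed.

Lemma approximable_preimage (X : R * R -> R) :
  measurable_fun [set: borel2 R] (X : borel2 R -> measurableTypeR R) ->
  (forall a, approximable [set u | a < X u]) ->
  forall Y : set (measurableTypeR R), measurable Y -> approximable (X @^-1` Y).
Proof.
move=> mX ray Y mY.
have {mY} : <<s @RGenOInfty.G R >> Y by rewrite -[<<s _ >>]RGenOInfty.measurableE.
move: Y; apply: smallest_sub; last first.
  move=> _ [a ->]; have := ray a; congr (approximable _).
  by apply/seteqP; split=> u /=; rewrite in_itv/= andbT.
split => /=.
- exact: approximable0.
- move=> Y; rewrite setTD preimage_setC; exact: approximableC.
- by move=> F hF; rewrite preimage_bigcup; exact: approximable_bigcup.
Qed.

Lemma measurable_approximable (B : set (borel2 R)) : measurable B -> approximable B.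
Proof.
have a1 (Y : set (measurableTypeR R)) : measurable Y -> approximable (fst @^-1` Y).
  apply: approximable_preimage => // a; apply: (@approximable_ray (1, 0)) => // u.
    by rewrite /plane_dot /= mulr1 mulr0 mul0r addr0.
  by case.
have a2 (Y : set (measurableTypeR R)) : measurable Y -> approximable (snd @^-1` Y).
  apply: approximable_preimage => // a; apply: (@approximable_ray (0, 1)) => // u.
    by rewrite /plane_dot /= mulr1 mulr0 mul0r add0r.
  by case.
rewrite measurable_prod_measurableType; move: B; apply: smallest_sub; last first.
  move=> _ [Y mY [Z mZ <-]]; exact: approximableI (a1 _ mY) (a2 _ mZ).
split => /=.
- exact: approximable0.
- by move=> Y; rewrite setTD; exact: approximableC.
- by move=> F hF; exact: approximable_bigcup.
Qed.

End Approximation.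
End Trig.

(** * Removing the low frequencies *)

Section LowFrequencies.
Variables (R : realType) (om : R).
Hypothesis om0 : 0 < om.
Implicit Types (u v : R * R) (p q : R * R -> R) (z w : int * int).
Notation L := (half_period om).
Notation leb := (@lebesgue_measure R).

Let L0 : 0 < L.
Proof. by rewrite divr_gt0// pi_gt0. Qed.

Lemma sin_int_pi (k : int) : sin (k%:~R * pi) = 0 :> R.
Proof.
have h (n : nat) : sin (n%:R * pi) = 0 :> R.
  elim: n => [|n IH]; first by rewrite mul0r sin0.
  by rewrite -natr1 mulrDl mul1r sinD IH sinpi mul0r mulr0 addr0.
case: k => n; first exact: h.
by rewrite NegzE mulrNz mulNr sinN h oppr0.
Qed.

Lemma phase_int1_period (k : int) (t : R) :
  phase_int1 (cut L (fun=> 1)) (om * k%:~R) t =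
  if k == 0 then 2 * L * cos t else 0.
Proof.
have [->|k0] := eqVneq k 0.
  rewrite phase_int1_cut.
  transitivity (\int[leb]_(x in `[- L, L]) (cos t)).
    by apply: eq_Rintegral => x _; rewrite mulr0 mul0r add0r mulr1.
  have h : leb `[(- L)%R, L]%classic = (2 * L)%:E.
    have NLL : - L < L by have := L0; lra.
    rewrite lebesgue_measure_itv/= lte_fin NLL.
    by rewrite -EFinD; congr (_%:E); ring.
  by rewrite Rintegral_cst// [X in fine X](h) mulrC.
have c1 : C1 (fun=> 1 : R) (fun=> 0 : R).
  by split=> x; [exact: is_derive_cst|exact: cvg_cst].
have v0 : om * k%:~R != 0 by apply: mulf_neq0; [rewrite gt_eqF|rewrite intr_eq0].
apply: (mulfI v0); rewrite mulr0 (phase_int1_ibp _ _ L0 c1).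
have -> : phase_int1 (cut L (fun=> 0)) (om * k%:~R) (t + pi / 2) = 0.
  rewrite /phase_int1 /Rintegral integral0_eq// => x _.
  by rewrite /cut if_same mulr0.
have kL : om * k%:~R * L = k%:~R * pi.
  by rewrite /half_period; field; rewrite gt_eqF.
rewrite !mulr1 addr0 mulrN kL sinD -mulNr -mulrNz sinD !sin_int_pi.
by rewrite !mul0r !add0r mulrNz mulNr cosN subrr.
Qed.

Definition box u : R := cut L (fun=> 1) u.1 * cut L (fun=> 1) u.2.

Lemma tame1_cut1 : tame1 L (cut L (fun=> 1)).
Proof. by apply: tame1_cut; exact: cst_continuous. Qed.

Lemma tame_box : tame L box.
Proof. exact: tame_prod tame1_cut1 tame1_cut1. Qed.

Lemma boxE u : box u = \1_(square L) u.
Proof.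
rewrite indicE /box /cut; have [[h1 h2]|h] := pselect (square L u).
  by rewrite mem_set//= ?h1 ?h2 mulr1.
rewrite memNset//=; case: ifP => h1; case: ifP => h2; rewrite ?mulr0 ?mul0r//.
by exfalso; apply: h.
Qed.

Lemma phase_int_box z (t : R) :
  phase_int box (freq om z) t = if z == 0 then (2 * L) ^+ 2 * cos t else 0.
Proof.
rewrite /box (phase_int_prod _ _ tame1_cut1 tame1_cut1) !phase_int1_period.
case: z => k l; rewrite /= -[(k, l) == 0]/((k == 0) && (l == 0)).
case: (k == 0); case: (l == 0); rewrite /= ?mulr0 ?mul0r ?subr0//.
by rewrite cosN cos_pihalf cos0; ring.
Qed.

Variable s : seq (int * int).
Hypothesis uniq_s : uniq s.
Hypothesis oppr_s : forall z, z \in s -> - z \in s.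

(** The orthogonal projection onto the frequencies in [s], as a convolution with the
    Dirichlet kernel: this form gives both linearity and a bound by the mean of [p]. *)
Definition low p u : R := ((2 * L) ^- 2) *
  \sum_(z <- s) phase_int (fun v => p v * box v) (freq om z) (- plane_dot (freq om z) u).

Lemma tame_trig_box adm p : trig om adm p -> tame L (fun v => p v * box v).
Proof.
move=> tp; have [K [_ pK]] := trig_bounded tp.
by apply: tameM_bounded pK; [exact: tame_box|exact: measurable_trig tp].
Qed.

(** Orthogonality; the symmetry of [s] enters because a cosine carries the
    frequencies [w] and [- w]. *)
Lemma low_wave w (t : R) u :
  low (wave om w t) u = if w \in s then wave om w t u else 0.
Proof.
rewrite /low.
have h z : phase_int (fun v => wave om w t v * box v) (freq om z) (- plane_dot (freq om z) u) =
   (if z == - w then (2 * L) ^+ 2 * (2^-1 * wave om w t u) else 0) +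
   (if z == w then (2 * L) ^+ 2 * (2^-1 * wave om w t u) else 0).
  set a := - plane_dot (freq om z) u.
  have -> : phase_int (fun v => wave om w t v * box v) (freq om z) a =
      2^-1 * phase_int box (freq om (z + w)) (a + t) +
      2^-1 * phase_int box (freq om (z - w)) (a - t).
    rewrite /phase_int.
    have i1 := tame_integrable (tame_cos (freq om (z + w)) (a + t) tame_box).
    have i2 := tame_integrable (tame_cos (freq om (z - w)) (a - t) tame_box).
    rewrite -!RintegralZl// -RintegralD//; last 2 first.
    - exact: integrable_EFinZl.
    - exact: integrable_EFinZl.
    apply: eq_Rintegral => v _; rewrite mulrA -/(wave om z a v) waveM.
    by rewrite /wave mulrDl !mulrA.
  rewrite !phase_int_box addr_eq0 subr_eq0; congr (_ + _).
    case: eqP => [zw|_]; last by rewrite mulr0.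
    rewrite mulrCA; congr (_ * (_ * cos _)); rewrite /a zw /plane_dot /freq /= !mulrNz; ring.
  case: eqP => [zw|_]; last by rewrite mulr0.
  rewrite mulrCA -[in LHS]cosN; congr (_ * (_ * cos _)); rewrite /a zw; ring.
under eq_bigr do rewrite h.
rewrite big_split /=.
have sel x c : \sum_(z <- s) (if z == x then c else 0) = if x \in s then c else 0 :> R.
  case: ifP => xs.
    rewrite (bigD1_seq x)//= eqxx big1 ?addr0// => z /negbTE zx.
    by rewrite zx.
  rewrite big1_seq// => z /andP[_ zs].
  by case: eqP => // zx; rewrite -zx zs in xs.
rewrite !sel.
have -> : (- w \in s) = (w \in s).
  by apply/idP/idP => /oppr_s; rewrite ?opprK.
case: ifP => _; last by rewrite addr0 mulr0.
by field; rewrite gt_eqF.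
Qed.

Lemma low_lin p q (a b : R) u : trig om allfreq p -> trig om allfreq q ->
  low (fun v => a * p v + b * q v) u = a * low p u + b * low q u.
Proof.
move=> tp tq; rewrite /low.
have -> : \sum_(z <- s) phase_int (fun v => (a * p v + b * q v) * box v)
      (freq om z) (- plane_dot (freq om z) u) =
    a * (\sum_(z <- s) phase_int (fun v => p v * box v) (freq om z) (- plane_dot (freq om z) u))
    + b * \sum_(z <- s) phase_int (fun v => q v * box v) (freq om z) (- plane_dot (freq om z) u).
  rewrite !mulr_sumr -big_split /=; apply: eq_bigr => z _.
  rewrite -(phase_int_lin _ _ _ _ (tame_trig_box tp) (tame_trig_box tq)).
  by congr (phase_int _ _ _); apply/funext => v; ring.
ring.
Qed.

Lemma high_part z0 p : z0 \notin s -> trig om allfreq p ->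
  trig om (fun z => z \notin s) (fun u => p u - low p u).
Proof.
move=> z0s; elim=> [w t _|a b p1 p2 t1 h1 t2 h2]; last first.
  apply: trig_eq (trig_lin a b h1 h2) _ => u; rewrite low_lin//; ring.
have [ws|ws] := boolP (w \in s).
  have t0 : trig om (fun z => z \notin s) (wave om z0 0) by exact: trig_wave.
  apply: trig_eq (trig_lin 0 0 t0 t0) _ => u.
  by rewrite low_wave ws subrr !mul0r addr0.
have t0 : trig om (fun z => z \notin s) (wave om w t) by exact: trig_wave.
by apply: trig_eq t0 _ => u; rewrite low_wave (negbTE ws) subr0.
Qed.

Lemma low_le q (K : R) u : trig om allfreq q -> (forall v, 0 <= q v) ->
  \int[lebesgue2 R]_v (q v * box v) <= K ->
  `|low q u| <= (2 * L) ^- 2 * (size s)%:R * K.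
Proof.
move=> tq q0 qK; rewrite /low normrM.
have b0 : 0 < (2 * L) ^- 2 by rewrite invr_gt0 exprn_gt0// mulr_gt0.
rewrite (gtr0_norm b0) -mulrA ler_wpM2l//; first exact: ltW.
apply: le_trans (ler_norm_sum _ _ _) _.
have -> : (size s)%:R * K = \sum_(z <- s) K.
  by rewrite big_const_seq count_predT iter_addr_0 mulr_natl.
apply: ler_sum => z _.
have tb := tame_trig_box tq.
apply: le_trans qK; rewrite /phase_int.
have i1 := tame_integrable (tame_cos (freq om z) (- plane_dot (freq om z) u) tb).
apply: le_trans (le_normr_Rintegral _ i1) _ => //.
apply: le_Rintegral => //.
- exact: integrable_norm.
- exact: tame_integrable tb.
- move=> v _; rewrite normrM -[leRHS]mul1r ler_pM ?cos_max//.
  by rewrite ger0_norm// mulr_ge0// boxE; have /andP[] := indic01 (square L) v.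
Qed.

(** Multiplying a transform by a wave of frequency [y] amounts to translating the
    function by [y]: when all the frequencies are large, the translates leave the
    square. Averaging the shifts by [y] and by [- y] keeps the function real. *)
Lemma multiplier (adm : int * int -> Prop) r0 r g h : tame r0 g ->
  (forall z, adm z -> r0 + r < `|(freq om z).1| \/ r0 + r < `|(freq om z).2|) ->
  trig om adm h ->
  exists r1 f, [/\ tame r1 f, forall x, square r x -> f x = 0 &
    forall u t, phase_int f u t = 2^-1 * (h u + h (- u)) * phase_int g u t].
Proof.
move=> tg adm_far; elim=> [z th admz|a b h1 h2 _ [r1 [f1 [tf1 s1 e1]]]
  _ [r2 [f2 [tf2 s2 e2]]]]; last first.
  exists (Num.max r1 r2), (fun x => a * f1 x + b * f2 x).
  have t1 : tame (Num.max r1 r2) f1 by apply: tame_widen tf1; rewrite le_max lexx.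
  have t2 : tame (Num.max r1 r2) f2 by apply: tame_widen tf2; rewrite le_max lexx orbT.
  split; first exact: tame_lin.
  - by move=> x xr; rewrite s1// s2// !mulr0 addr0.
  - by move=> u t; rewrite (phase_int_lin _ _ _ _ t1 t2) e1 e2; ring.
pose y := freq om z.
have shiftE (c x : R * R) : plane_iso false c x = x + c.
  by rewrite /plane_iso /line_iso expr0 !mul1r; case: x; case: c.
have tsh (c : R * R) : tame (r0 + Num.max `|c.1| `|c.2|) (fun x => g (x + c)).
  have := tame_iso false c tg; congr (tame _ _).
  by apply/funext => x; rewrite /= shiftE.
have ta := tsh (- y); have tb := tsh (- - y).
have nE : Num.max `|(- - y).1| `|(- - y).2| = Num.max `|(- y).1| `|(- y).2|.
  by rewrite /= !normrN.
rewrite nE in tb.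
pose k := 2^-1 * cos th.
exists (r0 + Num.max `|(- y).1| `|(- y).2|), (fun x => k * g (x - y) + k * g (x - - y)).
split; first exact: tame_lin.
- move=> x [x1 x2]; have [_ _ gr] := tg.
  have far (a b : R) : `|a| <= r -> r0 + r < `|b| -> ~ `|a - b| <= r0 /\ ~ `|a + b| <= r0.
    move=> ar rb; split=> ab.
      have := ler_normB a (a - b); rewrite subKr; lra.
    have := ler_normB (a + b) a; have -> : a + b - a = b by ring.
    lra.
  have out : ~ square r0 (x - y) /\ ~ square r0 (x - - y).
    rewrite opprK; have [far0|far0] := adm_far z admz.
      by have [f1 f2] := far _ _ x1 far0; split=> -[].
    by have [f1 f2] := far _ _ x2 far0; split=> -[].
  by rewrite (gr _ out.1) (gr _ out.2) mulr0 addr0.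
- move=> u t; rewrite (phase_int_lin _ _ _ _ ta tb) !(phase_int_shift _ _ _ tg).
  have i1 := tame_integrable (tame_cos u (t + plane_dot u y) tg).
  have i2 := tame_integrable (tame_cos u (t + plane_dot u (- y)) tg).
  have i3 := tame_integrable (tame_cos u t tg).
  rewrite /phase_int -!RintegralZl// -RintegralD//; last 2 first.
  - exact: integrable_EFinZl.
  - exact: integrable_EFinZl.
  apply: eq_Rintegral => x _; rewrite /wave.
  have -> : plane_dot (freq om z) u = plane_dot u y by rewrite /plane_dot /y; ring.
  have -> : plane_dot (freq om z) (- u) = - plane_dot u y by rewrite /plane_dot /y /=; ring.
  have -> : plane_dot u (- y) = - plane_dot u y by rewrite /plane_dot /=; ring.
  have -> : plane_dot u x + (t + plane_dot u y) = (plane_dot u x + t) + plane_dot u y by ring.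
  have -> : plane_dot u x + (t - plane_dot u y) = (plane_dot u x + t) - plane_dot u y by ring.
  rewrite (cosD (plane_dot u x + t)) (cosB (plane_dot u x + t)) (cosD (plane_dot u y)).
  rewrite (cosD (- plane_dot u y)) cosN sinN /k; ring.
Qed.

End LowFrequencies.

(** * Multipliers that cancel a null set *)

Definition int_range (K : nat) : seq int :=
  [seq (i%:Z - K%:Z)%R | i <- iota 0 (K.*2.+1)].

Definition grid (K : nat) : seq (int * int) :=
  [seq (x, y) | x <- int_range K, y <- int_range K].

Lemma mem_int_range K (k : int) : (k \in int_range K) = (`|k| <= K)%N.
Proof.
apply/mapP/idP; first by case=> i; rewrite mem_iota => ? ->; lia.
move=> kK; exists (absz (k + K%:Z)); last lia.
by rewrite mem_iota; lia.
Qed.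

Lemma uniq_grid K : uniq (grid K).
Proof.
have u : uniq (int_range K).
  by rewrite map_inj_uniq ?iota_uniq// => i j; lia.
by apply: allpairs_uniq => // -[a b] [c d].
Qed.

Lemma mem_grid K (z : int * int) : (z \in grid K) = (`|z.1| <= K)%N && (`|z.2| <= K)%N.
Proof.
case: z => a b; apply/allpairsP/andP => /=.
  by case=> -[x y] /= [hx hy [-> ->]]; rewrite -!mem_int_range.
by case=> ha hb; exists (a, b); rewrite !mem_int_range.
Qed.

Lemma opp_grid K (z : int * int) : z \in grid K -> - z \in grid K.
Proof. by rewrite !mem_grid /= !abszN. Qed.

Lemma notin_grid K : (K.+1%:Z, 0) \notin grid K.
Proof. by rewrite mem_grid /= ltnn. Qed.

Section Singular.
Variables (R : realType) (om : R).
Hypothesis om0 : 0 < om.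
Notation L := (half_period om).
Variables (S : {measure set (borel2 R) -> \bar R}) (N : set (borel2 R)).
Hypothesis S_cell : (S (cell om) < +oo)%E.
Hypothesis mN : measurable N.
Hypothesis N0 : lebesgue2 R N = 0%E.
Hypothesis Nsym : forall u, N u -> N (- u).

Let L0 : 0 < L.
Proof. by rewrite divr_gt0// pi_gt0. Qed.

Lemma lebesgue2_cell : lebesgue2 R (cell om) = ((2 * L) ^+ 2)%:E.
Proof.
rewrite cellE lebesgue2X//.
have NLL : - L < L by have := L0; lra.
rewrite !lebesgue_measure_itv/= lte_fin NLL -EFinD -EFinM; congr (_%:E); ring.
Qed.

Lemma lebesgue2_rim : lebesgue2 R (square L `\` cell om) = 0%E.
Proof.
rewrite measureD//; [|exact: measurable_square|exact: measurable_cell|].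
  rewrite (_ : square L `&` cell om = cell om); last first.
    by apply/setIidr => u [h1 h2]; split; exact: ltW.
  rewrite [X in (X - _)%E](lebesgue2_square (ltW L0)) [X in (_ - X)%E]lebesgue2_cell.
  by rewrite -EFinB subrr.
by rewrite [X in (X < _)%E](lebesgue2_square (ltW L0)) ltry.
Qed.

(** The polynomial close to the indicator of the null set is small in mean, hence
    has small coefficients: its low frequencies can be dropped. *)
Lemma singular_multiplier K (e : R) : 0 < e -> exists h,
  [/\ trig om (fun z => z \notin grid K) h,
    forall u, `|1 - 2^-1 * (h u + h (- u))| <= 2 &
    (\int[S]_(u in cell om `&` N) `|1 - 2^-1 * (h u + h (- u))|%:E < e%:E)%E].
Proof.
move=> e0; set s := grid K.
pose ka : R := (2 * L) ^- 2 * (size s)%:R.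
have ka0 : 0 <= ka by rewrite mulr_ge0// invr_ge0 exprn_ge0// mulr_ge0// ltW.
have mcell := measurable_cell om.
pose Sc := fine (S (cell om)).
have ScE : S (cell om) = Sc%:E by rewrite fineK// ge0_fin_numE.
have Sc0 : 0 <= Sc by exact: fine_ge0.
pose eta := Num.min (ka + 1)^-1 (e / (1 + ka * Sc)).
have k1 : 0 < 1 + ka * Sc by rewrite ltr_pwDl// mulr_ge0.
have ka1 : 0 < ka + 1 by lra.
have eta0 : 0 < eta by rewrite lt_min invr_gt0 ka1 divr_gt0.
pose nu := measure_add S (lebesgue2 R).
have nu_fin : (nu (cell om) < +oo)%E.
  by rewrite /nu measure_addE ScE lebesgue2_cell -EFinD ltry.
have [_ /(_ _ eta0) [q [tq q01]]] := measurable_approximable om0 nu_fin mN.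
have mq := measurable_trig tq.
have merr : measurable_fun (cell om) (fun u => (err q N u)%:E).
  by apply/measurable_EFinP; apply: measurable_funTS; exact: measurable_err.
rewrite ge0_integral_measure_add//; last by move=> u _; rewrite lee_fin err_ge0.
set IS := (\int[S]_(u in _) _)%E; set IL := (\int[lebesgue2 R]_(u in _) _)%E => Ieta.
have IS0 : (0 <= IS)%E by apply: integral_ge0 => u _; rewrite lee_fin err_ge0.
have IL0 : (0 <= IL)%E by apply: integral_ge0 => u _; rewrite lee_fin err_ge0.
have ISe : (IS < eta%:E)%E by apply: le_lt_trans Ieta; rewrite leeDl.
have ILe : (IL < eta%:E)%E by apply: le_lt_trans Ieta; rewrite leeDr.
have q0 u : 0 <= q u by have /andP[] := q01 u.
have q1 u : q u <= 1 by have /andP[] := q01 u.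
have mean : \int[lebesgue2 R]_v (q v * box om v) <= eta.
  have tb := tame_trig_box tq.
  have b0 v : 0 <= q v * box om v.
    by rewrite mulr_ge0// boxE; have /andP[] := indic01 (square L) v.
  rewrite /Rintegral -lee_fin fineK; last exact: integrable_fin_num (tame_integrable tb).
  (* the cell is open; its rim in the closed square is a null set *)
  pose N' := N `|` (square L `\` cell om).
  have mN' : measurable N'.
    by apply: measurableU => //; apply: measurableD => //; exact: measurable_square.
  have N'0 : lebesgue2 R N' = 0%E.
    apply/eqP; rewrite -measure_le0; apply: le_trans (measureU2 _ _ _) _ => //.
      by apply: measurableD => //; exact: measurable_square.
    by rewrite [X in (X + _)%E]N0 [X in (_ + X)%E]lebesgue2_rim adde0.
  apply: (@le_trans _ _ (\int[lebesgue2 R]_v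
      ((err q N v)%:E * (\1_(cell om) v)%:E + (\1_N' v)%:E)))%E.
    apply: ge0_le_integral => //.
    - by move=> v _; rewrite lee_fin.
    - by apply/measurable_EFinP; have [] := tb.
    - apply: emeasurable_funD; last exact/measurable_EFinP.
      by apply: emeasurable_funM; apply/measurable_EFinP => //; exact: measurable_err.
    - move=> v _; rewrite -EFinM -EFinD lee_fin boxE !indicE.
      have [vs|vs] := pselect (square L v); last first.
        by rewrite (memNset vs) mulr0 addr_ge0// mulr_ge0// err_ge0.
      rewrite (mem_set vs) mulr1.
      have [vc|vc] := pselect (cell om v); last first.
        rewrite (@mem_set _ N' v); last by right.
        by apply: le_trans (q1 v) _; rewrite lerDr mulr_ge0// err_ge0.
      rewrite (mem_set vc) mulr1.
      have [vN|vN] := pselect (N v).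
        rewrite (@mem_set _ N' v); last by left.
        by apply: le_trans (q1 v) _; rewrite lerDr err_ge0.
      apply: ler_wpDr => //; rewrite /err indicE (memNset vN) subr0 ger0_norm//.
      by rewrite lerDl.
  rewrite ge0_integralD//; last 3 first.
  - by move=> v _; rewrite -EFinM lee_fin mulr_ge0// err_ge0.
  - by apply: emeasurable_funM; apply/measurable_EFinP => //; exact: measurable_err.
  - exact/measurable_EFinP.
  rewrite integral_indic// setIT [X in (_ + X)%E]N'0 adde0.
  apply: le_trans (ltW ILe); rewrite /IL [leRHS]integral_mkcond.
  rewrite le_eqVlt; apply/orP; left; apply/eqP; apply: eq_integral => v _.
  rewrite patchE indicE; case: ifP => _; first by rewrite mule1.
  by rewrite mule0.
pose lo := low om s q; pose h u := q u - lo u.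
have lo_le u : `|lo u| <= ka * eta by exact: low_le.
have kaeta : ka * eta <= 1.
  apply: (@le_trans _ _ ((ka + 1) * (ka + 1)^-1)); last by rewrite divff// gt_eqF.
  by apply: ler_pM => //; [exact: ltW|lra|rewrite ge_min lexx].
have th := high_part om0 (uniq_grid K) (@opp_grid K) (notin_grid K) tq.
have mh : measurable_fun [set: borel2 R] (h : R * R -> R) := measurable_trig th.
exists h; split; first exact: th.
- move=> u; have := lo_le u; have := lo_le (- u); rewrite !ler_norml /h.
  have := q0 u; have := q0 (- u); have := q1 u; have := q1 (- u).
  by move=> ? ? ? ? /andP[? ?] /andP[? ?]; apply/andP; split; lra.
have mD : measurable (cell om `&` N) by exact: measurableI.
have mm : measurable_fun [set: borel2 R] (fun u => `|1 - 2^-1 * (h u + h (- u))|).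
  apply: measurableT_comp => //; apply: measurable_funB => //.
  apply: measurable_funM => //; apply: measurable_funD => //.
  exact: (measurableT_comp mh (@measurable_opp2 R)).
have merr2 : measurable_fun (cell om) (fun u => (2^-1)%:E * (err q N u)%:E + (ka * eta)%:E)%E.
  by apply: emeasurable_funD => //; apply: emeasurable_funM.
apply: (@le_lt_trans _ _ ((2^-1)%:E * IS + (ka * eta)%:E * S (cell om))%E).
  apply: (@le_trans _ _ (\int[S]_(u in cell om `&` N)
      ((2^-1)%:E * (err q N u)%:E + (ka * eta)%:E)))%E.
    apply: ge0_le_integral => //.
    + by apply/measurable_EFinP; exact: measurable_funTS mm.
    + exact: measurable_funS merr2.
    + move=> u [_ Nu]; rewrite -EFinM -EFinD lee_fin /err !indicE.
      rewrite (mem_set Nu) (mem_set (Nsym Nu)) /=.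
      rewrite (distrC (q u)) (distrC (q (- u))) (ger0_norm (_ : 0 <= 1 - q u)) ?subr_ge0//.
      rewrite (ger0_norm (_ : 0 <= 1 - q (- u))) ?subr_ge0// /h.
      have := lo_le u; have := lo_le (- u); have := q1 u; have := q1 (- u).
      rewrite !ler_norml => ? ? /andP[? ?] /andP[? ?].
      by apply/andP; split; lra.
  apply: (@le_trans _ _ (\int[S]_(u in cell om) ((2^-1)%:E * (err q N u)%:E + (ka * eta)%:E)))%E.
    apply: ge0_subset_integral => //.
    by move=> u _; rewrite -EFinM -EFinD lee_fin addr_ge0// mulr_ge0// ?err_ge0// ltW.
  rewrite ge0_integralD//; last 3 first.
  - by move=> u _; rewrite -EFinM lee_fin mulr_ge0// err_ge0.
  - exact: emeasurable_funM.
  - by move=> u _; rewrite lee_fin mulr_ge0// ltW.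
  rewrite ge0_integralZl_EFin//; last by move=> u _; rewrite lee_fin err_ge0.
  by rewrite integral_cst.
have ISfin : IS \is a fin_num by rewrite ge0_fin_numE// (lt_trans ISe)// ltry.
move: ISe IS0; rewrite ScE -(fineK ISfin) lte_fin lee_fin => ISe IS0.
rewrite -!EFinM -EFinD lte_fin.
have : eta * (1 + ka * Sc) <= e by rewrite -ler_pdivlMr// ge_min lexx orbT.
by lra.
Qed.

End Singular.

(** * Integrability of the weight *)

Section Weight.
Variable R : realType.
Implicit Types (u : R * R) (v t : R).

Lemma C1_expRN : C1 (fun x : R => expR (- x)) (fun x => - expR (- x)).
Proof.
have d (x : R) : is_derive x 1 (fun x : R => expR (- x)) (- expR (- x)).
  rewrite -[X in is_derive _ _ _ X]mulrN1.
  by apply: (@is_derive1_comp _ expR (fun x : R => - x)).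
split=> // x; apply: cvgN; exact: (derive_continuous d).
Qed.

Definition expcut : R -> R := cut 1 (fun x => expR (- x)).

Lemma tame1_expcut : tame1 1 expcut.
Proof. by apply: tame1_cut; have [d _] := C1_expRN; exact: derive_continuous d. Qed.

(** Integration by parts gives a linear system for the cosine and sine transforms,
    solved by taking the sum of two squares. Unlike that of an indicator, the
    transform of a truncated exponential has no zeros. *)
Lemma power1_expcut v : (expR 1 - expR (- 1)) ^+ 2 * weight1 v <= power1 expcut v.
Proof.
have v0 : 0 < 1 + v ^+ 2 by rewrite ltr_pwDl// sqr_ge0.
rewrite /weight1 ler_pdivrMr// mulrC.
have ibp t : v * phase_int1 expcut v t =
    sin (v + t) * expR (- 1) - sin (- v + t) * expR 1 - phase_int1 expcut v (t + pi / 2).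
  rewrite (phase_int1_ibp v t ltr01 C1_expRN) mulr1 mulrN1 opprK; congr (_ + _).
  rewrite /phase_int1 -[RHS]mulN1r -RintegralZl//; last first.
    exact: tame1_integrable (tame1_cos _ _ tame1_expcut).
  by apply: eq_Rintegral => x _; rewrite /expcut /cut; case: ifP => _; ring.
rewrite /power1; set C := phase_int1 expcut v 0; set D := phase_int1 expcut v (- (pi / 2)).
have e1 := ibp (- (pi / 2)); have e2 := ibp 0.
rewrite -/D addNr -/C in e1; rewrite -/C !addr0 add0r in e2.
have p3 : phase_int1 expcut v (pi / 2) = - D.
  rewrite /D /phase_int1 -[RHS]mulN1r -RintegralZl//; last first.
    exact: tame1_integrable (tame1_cos _ _ tame1_expcut).
  by apply: eq_Rintegral => x _; rewrite cosDpihalf cosBpihalf mulrA mulN1r.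
rewrite p3 in e2.
have f1 : C + v * D = cos v * (expR 1 - expR (- 1)).
  by rewrite e1 -opprD sinN sinBpihalf sinDpihalf; ring.
have f2 : v * C - D = sin v * (expR 1 + expR (- 1)).
  by rewrite e2 sinN; ring.
have -> : (1 + v ^+ 2) * (C ^+ 2 + D ^+ 2) = (C + v * D) ^+ 2 + (v * C - D) ^+ 2 by ring.
rewrite f1 f2 !exprMn.
have e12 : (expR 1 - expR (- 1)) ^+ 2 = cos v ^+ 2 * (expR 1 - expR (- 1)) ^+ 2
    + sin v ^+ 2 * (expR 1 - expR (- 1)) ^+ 2 :> R by rewrite -mulrDl cos2Dsin2 mul1r.
rewrite [leLHS]e12.
rewrite lerD2l ler_wpM2l ?sqr_ge0//.
rewrite -subr_ge0.
have -> : (expR 1 + expR (- 1)) ^+ 2 - (expR 1 - expR (- 1)) ^+ 2 =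
    4 * (expR 1 * expR (- 1)) :> R by ring.
by rewrite !mulr_ge0// expR_ge0.
Qed.

Lemma measurable_weight : measurable_fun [set: borel2 R] (@weight R).
Proof.
have h (X : borel2 R -> measurableTypeR R) : measurable_fun setT X ->
    measurable_fun [set: borel2 R] (fun u => weight1 (X u)).
  move=> mX; apply: (measurableT_comp _ mX).
  apply: continuous_measurable_fun => v; apply: cvgV.
    by rewrite gt_eqF// ltr_pwDl// sqr_ge0.
  apply: cvgD; first exact: cvg_cst.
  exact: exprn_continuous.
by apply: measurable_funM; apply: h.
Qed.

Lemma weight_le1 u : weight u <= 1.
Proof.
have h v : 0 <= weight1 v <= 1.
  by rewrite ltW ?weight1_gt0//= invf_le1 ?lerDl ?sqr_ge0// ltr_pwDl// sqr_ge0.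
have /andP[? ?] := h u.1; have /andP[? ?] := h u.2.
by rewrite /weight mulr_ile1.
Qed.

Lemma weight_ge u (k : R) : 0 <= k -> `|u.1| <= k -> `|u.2| <= k ->
  (1 + k ^+ 2) ^- 2 <= weight u.
Proof.
move=> k0 u1 u2.
have h v : `|v| <= k -> (1 + k ^+ 2)^-1 <= weight1 v.
  move=> vk; rewrite lef_pV2 ?posrE ?ltr_pwDl ?sqr_ge0// lerD2l.
  by rewrite -(real_normK (num_real v)) lerXn2r ?nnegrE.
rewrite -exprVn expr2 /weight; apply: ler_pM; rewrite ?invr_ge0 ?addr_ge0 ?sqr_ge0//; exact: h.
Qed.

End Weight.

(** The variance of the random measure at a truncated exponential is finite and its
    power dominates the weight. *)
Lemma weight_integrable (d : measure_display) (T : measurableType d)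
  (R : realType) (P : probability T R) (M : (R * R -> R) -> T -> R)
  (S : {measure set (borel2 R) -> \bar R}) :
  WSS_random_measure P M S ->
  (\int[S]_(u in [set: borel2 R]) (weight u)%:E < +oo)%E.
Proof.
move=> hM.
pose f := fun x : R * R => expcut x.1 * expcut x.2.
have tf : tame 1 f := tame_prod (@tame1_expcut R) (@tame1_expcut R).
have cf := tame_Ccb tf.
have vfin : ('V_P[M f] < +oo)%E.
  by rewrite -ge0_fin_numE ?variance_ge0// variance_fin_num// (random_measure_L2 (WSS_L2 hM)).
rewrite (WSS_spectral hM cf) in vfin.
pose k : R := (expR 1 - expR (- 1)) ^+ 2.
have k0 : 0 < k.
  by rewrite exprn_gt0// subr_gt0 ltr_expR; lra.
have pk u : k ^+ 2 * weight u <= power f u.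
  rewrite (@power_prod _ 1) /weight; [|exact: tame1_expcut..].
  have -> : k ^+ 2 * (weight1 u.1 * weight1 u.2) = (k * weight1 u.1) * (k * weight1 u.2) by ring.
  have kw v : 0 <= k * weight1 v by rewrite mulr_ge0 ?sqr_ge0// ltW// weight1_gt0.
  by apply: ler_pM => //; exact: power1_expcut.
have h : (\int[S]_u (weight u)%:E <= (k ^- 2)%:E * \int[S]_u (power f u)%:E)%E.
  rewrite -ge0_integralZl_EFin//; last 3 first.
  - by move=> u _; rewrite lee_fin power_ge0.
  - by apply/measurable_EFinP; exact: measurable_power tf.
  - by rewrite invr_ge0 exprn_ge0// ltW.
  apply: ge0_le_integral => //.
  - by move=> u _; rewrite lee_fin ltW// weight_gt0.
  - by apply/measurable_EFinP; exact: measurable_weight.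
  - by apply: emeasurable_funM => //; apply/measurable_EFinP; exact: measurable_power tf.
  - move=> u _; rewrite -EFinM lee_fin mulrC ler_pdivlMr ?exprn_gt0//.
    by rewrite mulrC.
apply: le_lt_trans h _; apply: lte_mul_pinfty => //.
  by rewrite lee_fin invr_ge0 exprn_ge0// ltW.
have := vfin; under eq_integral do rewrite normc_fourier2.
have c0 : 0 < (2 * pi) ^- 2 :> R by rewrite invr_gt0 exprn_gt0// mulr_gt0// pi_gt0.
have I0 : (0 <= \int[S]_u (power f u)%:E)%E.
  by apply: integral_ge0 => u _; rewrite lee_fin power_ge0.
rewrite !ltey; apply: contra => /eqP ->.
by rewrite gt0_muley ?lte_fin.
Qed.

(** * Extensions of the constant one with small power *)

Lemma le_integral_EFin d (T : measurableType d) (R : realType)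
    (mu : {measure set T -> \bar R}) (D : set T) (f g : T -> R) :
  measurable D -> measurable_fun D f -> measurable_fun D g ->
  (forall x, D x -> 0 <= f x) -> (forall x, D x -> f x <= g x) ->
  (\int[mu]_(x in D) (f x)%:E <= \int[mu]_(x in D) (g x)%:E)%E.
Proof.
move=> mD mf mg f0 fg; apply: ge0_le_integral => //.
- exact/measurable_EFinP.
- exact/measurable_EFinP.
Qed.

Section Extension.
Variable R : realType.
Implicit Types (u : R * R) (v t r : R).
Variable S : {measure set (borel2 R) -> \bar R}.

Definition strip (x del tau : R) : set (borel2 R) :=
  [set u | `|u.1 - x| < del /\ `|u.2| <= tau].

Lemma stripE x del tau :
  strip x del tau = `]x - del, x + del[%classic `*` `[- tau, tau]%classic.
Proof.
by apply/seteqP; split=> -[a b] /=; rewrite !in_itv/= -ler_norml -ltr_distl.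
Qed.

Lemma measurable_strip x del tau : measurable (strip x del tau).
Proof. by rewrite stripE; apply: measurableX. Qed.

Lemma lebesgue2_strip x del tau : 0 < del -> 0 <= tau ->
  lebesgue2 R (strip x del tau) = (4 * del * tau)%:E.
Proof.
move=> del0; rewrite le_eqVlt => tau0; rewrite stripE lebesgue2X//.
have xd : x - del < x + del by lra.
rewrite !lebesgue_measure_itv/= !lte_fin xd.
case/predU1P: tau0 => [<-|tau0].
  by rewrite oppr0 ltxx mule0 mulr0.
have -> : - tau < tau by lra.
by rewrite -!EFinD -EFinM; congr (_%:E); ring.
Qed.

Hypothesis S_weight : (\int[S]_(u in [set: borel2 R]) (weight u)%:E < +oo)%E.

Let W : R := fine (\int[S]_(u in [set: borel2 R]) (weight u)%:E).

Let W0 : 0 <= W.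
Proof. by apply: fine_ge0; apply: integral_ge0 => u _; rewrite lee_fin ltW// weight_gt0. Qed.

Let WE : (\int[S]_(u in [set: borel2 R]) (weight u)%:E)%E = W%:E.
Proof.
rewrite fineK// ge0_fin_numE//; apply: integral_ge0 => u _.
by rewrite lee_fin ltW// weight_gt0.
Qed.

Let mw : measurable_fun [set: borel2 R] (fun u => (weight u)%:E).
Proof. by apply/measurable_EFinP; exact: measurable_weight. Qed.

Let w0 u : (0 <= (weight u)%:E)%E.
Proof. by rewrite lee_fin ltW// weight_gt0. Qed.

Lemma cell_finite om : 0 < om -> (S (cell om) < +oo)%E.
Proof.
move=> om0; have L0 : 0 <= half_period om by rewrite divr_ge0 ?pi_ge0// ltW.
pose k : R := (1 + half_period om ^+ 2) ^- 2.
have k0 : 0 < k by rewrite invr_gt0 exprn_gt0// ltr_pwDl// sqr_ge0.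
have h : (k%:E * S (cell om) <= W%:E)%E.
  rewrite -integral_cst; last exact: measurable_cell.
  rewrite -WE; apply: (@le_trans _ _ (\int[S]_(u in cell om) (weight u)%:E)%E).
    apply: (@le_integral_EFin _ _ _ S _ (fun=> k)).
    - exact: measurable_cell.
    - exact: measurable_cst.
    - exact: measurable_funTS (@measurable_weight R).
    - by move=> u _; exact: ltW.
    - by move=> u [h1 h2]; apply: weight_ge => //; exact: ltW.
  apply: ge0_subset_integral => //; exact: measurable_cell.
rewrite ltey; apply: contraTN h => /eqP ->.
by rewrite gt0_muley ?lte_fin// -ltNge ltry.
Qed.

(** The weight being integrable, all but a small part of it lies in one cell. *)
Lemma weight_tail (e : R) : 0 < e -> exists2 om, 0 < om &
  (\int[S]_(u in ~` cell om) (weight u)%:E < e%:E)%E.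
Proof.
move=> e0; pose om n : R := n.+1%:R^-1.
have om0 n : 0 < om n by rewrite invr_gt0.
have mc n : measurable (~` cell (om n)).
  by apply: measurableC; exact: measurable_cell.
have := @dominated_convergence _ _ R S [set: borel2 R] measurableT
  (fun n u => (weight u)%:E * (\1_(~` cell (om n)) u)%:E)%E (cst 0%E) (fun u => (weight u)%:E).
case.
- by move=> n; apply: emeasurable_funM => //; apply/measurable_EFinP.
- exact: measurable_cst.
- apply: aeW => u _; apply: cvg_near_cst.
  have m0 : 0 <= Num.max `|u.1| `|u.2| by rewrite le_max normr_ge0.
  exists (Num.bound (Num.max `|u.1| `|u.2|)) => // n /= nb.
  rewrite indicE memNset ?mule0//= => h; apply: h.
  have : Num.max `|u.1| `|u.2| < half_period (om n).
    apply: lt_le_trans (archi_boundP m0) _.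
    rewrite /half_period /om invrK; apply: (@le_trans _ _ n.+1%:R).
      by rewrite ler_nat; exact: leq_trans nb _.
    by rewrite -[leLHS]mul1r ler_wpM2r// (le_trans _ (pi_ge2 R))// ler1n.
  by rewrite gt_max => /andP[].
- by apply/integrableP; split => //; under eq_integral do rewrite gee0_abs//.
- apply: aeW => u n _; have /andP[i0 i1] := indic01 (~` cell (om n)) u.
  rewrite gee0_abs -EFinM lee_fin; last by rewrite mulr_ge0// ltW// weight_gt0.
  by rewrite -[leRHS]mulr1 ler_wpM2l// ltW// weight_gt0.
move=> _ _; rewrite integral0 => /fine_cvgP[fin cv].
have cve := cvgr_lt _ cv _ e0.
near \oo => n; exists (om n) => //.
have -> : (\int[S]_(u in ~` cell (om n)) (weight u)%:E)%E =
    (\int[S]_u ((weight u)%:E * (\1_(~` cell (om n)) u)%:E))%E.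
  rewrite integral_mkcond; apply: eq_integral => u _.
  by rewrite patchE indicE; case: ifP; rewrite ?mule1 ?mule0.
have finn : (\int[S]_u ((weight u)%:E * (\1_(~` cell (om n)) u)%:E))%E \is a fin_num.
  by near: n; exact: fin.
by rewrite -(fineK finn) lte_fin; near: n; exact: cve.
Unshelve. all: by end_near. Qed.

(* [N] carries the singular part of [S]; [S_strip] is what the quadratic bound on
   the density gives off [N], in thin strips through the two critical points. *)
Variables (N : set (borel2 R)) (del c : R).
Hypothesis mN : measurable N.
Hypothesis N0 : lebesgue2 R N = 0%E.
Hypothesis Nsym : forall u, N u -> N (- u).
Hypothesis del0 : 0 < del.
Hypothesis del1 : del <= 1.
Hypothesis c0 : 0 <= c.
Hypothesis S_strip : forall x tau, (x = 1 \/ x = -1) -> 0 <= tau -> tau < del ->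
  (S (strip x del tau `&` ~` N) <= (c * tau ^+ 3)%:E)%E.

(** Off the null set, the bump spends almost no power: in the thin strips through
    the two critical points the quadratic vanishing of the density beats the height
    of the bump, and elsewhere its transform is negligible against the weight. *)
Lemma bump_off_null n : (0 < n)%N -> exists m, forall e : R, 0 < e -> exists t1, forall t,
  t1 <= t -> 1 <= t ->
  (\int[S]_(u in ~` N) (power (bump n m t ((t ^+ n) ^+ 12)) u)%:E <= e%:E)%E /\
  exists K, 0 <= K /\ forall u, power (bump n m t ((t ^+ n) ^+ 12)) u <= K * weight u.
Proof.
move=> n0; have [m [C [C0 hC]]] := bump_power n0 del0 del1; exists m => e e0.
pose z := C * W + 2 * C * c.
have z0 : 0 <= z by rewrite addr_ge0// !mulr_ge0.
exists (z / e + 2 / del) => t tt1 t1; set X := t ^+ n.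
have ze : 0 <= z / e by rewrite divr_ge0// ltW.
have d2 : 0 <= 2 / del by rewrite divr_ge0// ltW.
have td : 2 / del <= t by lra.
have tz : z / e <= t by lra.
have t0 : 0 < t by lra.
have tX : t <= X by rewrite -{1}[t]expr1; apply: ler_weXn2l.
have X1 : 1 <= X by lra.
have X0 : 0 < X by lra.
set p := power _; set tau : R := X ^- 9.
have tau0 : 0 <= tau by rewrite invr_ge0 exprn_ge0// ltW.
have taud : tau < del.
  have : tau <= X^-1.
    by rewrite lef_pV2 ?posrE ?exprn_gt0// -{1}[X]expr1; apply: ler_weXn2l.
  move=> /le_lt_trans; apply; rewrite invf_plt ?posrE//.
  have dX : 2 / del <= X by lra.
  have dV : 0 < del^-1 by rewrite invr_gt0.
  lra.
have hp u : p u <= C / X * weight u +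
    C * X ^+ 26 * (\1_(strip 1 del tau) u + \1_(strip (-1) del tau) u).
  have CX : 0 <= C * X ^+ 26 by rewrite mulr_ge0// exprn_ge0// ltW.
  have i1 : 0 <= \1_(strip 1 del tau) u :> R by have /andP[] := indic01 (strip 1 del tau) u.
  have i2 : 0 <= \1_(strip (-1) del tau) u :> R by have /andP[] := indic01 (strip (-1) del tau) u.
  have wp : 0 <= C / X * weight u.
    by apply: mulr_ge0; [rewrite divr_ge0// ltW|rewrite ltW// weight_gt0].
  have [h|[near1 u2 h]] := hC t u t1.
    by apply: le_trans h _; rewrite lerDl mulr_ge0// addr_ge0.
  apply: le_trans h _; apply: ler_wpDl => //; rewrite -[leLHS]mulr1 ler_wpM2l//.
  case: near1 => h1.
    by rewrite [X in X + _]indicE mem_set// lerDl.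
  by rewrite [X in _ + X]indicE mem_set ?lerDr//; split=> //=; rewrite opprK.
have tP : tame (X ^+ 12) (bump n m t (X ^+ 12)).
  apply: tame_bump; first exact: ltW.
  by apply: le_trans tX _; rewrite -{1}[X]expr1; apply: ler_weXn2l.
have mp : measurable_fun [set: borel2 R] p := measurable_power tP.
split; last first.
  exists (C / X + C * X ^+ 26 * 2 * 25); split.
    apply: addr_ge0; first by rewrite divr_ge0// ltW.
    by rewrite !mulr_ge0// exprn_ge0// ltW.
  move=> u; have [h|[near1 u2 h]] := hC t u t1; last first.
    apply: le_trans h _; have u12 : `|u.1| <= 2.
      case: near1 => h1.
        have h3 := lt_le_trans h1 del1.
        by have := ler_normD (u.1 - 1) 1; rewrite subrK normr1; lra.
      have h3 := lt_le_trans h1 del1.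
      by have := ler_normB (u.1 + 1) 1; rewrite addrK normr1; lra.
    have tau2 : tau <= 2 by have := del1; lra.
    have u22 : `|u.2| <= 2 := le_trans u2 tau2.
    have w25 : 1 <= 25 * weight u.
      have := weight_ge (ler0n _ 2) u12 u22.
      have -> : (1 + 2%:R ^+ 2) ^- 2 = 25^-1 :> R by congr (_^-1); ring.
      by move=> h25; rewrite -ler_pdivrMl// mulr1.
    have wu := ltW (weight_gt0 u).
    rewrite mulrDl; apply: ler_wpDl; first by apply: mulr_ge0 => //; rewrite divr_ge0// ltW.
    have CX : 0 <= C * X ^+ 26 by rewrite mulr_ge0// exprn_ge0// ltW.
    have -> : C * X ^+ 26 * 2 * 25 * weight u = C * X ^+ 26 * (2 * (25 * weight u)) by ring.
    by rewrite -[leLHS]mulr1 ler_wpM2l//; lra.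
  apply: le_trans h _; rewrite ler_wpM2r ?(ltW (weight_gt0 u))// lerDl.
  by rewrite !mulr_ge0// exprn_ge0// ltW.
have mNc : measurable (~` N) by exact: measurableC.
have ms x : measurable (strip x del tau) by exact: measurable_strip.
pose A := (\int[S]_(u in ~` N) ((C / X)%:E * (weight u)%:E))%E.
have Ale : (A <= (C / X * W)%:E)%E.
  rewrite /A ge0_integralZl_EFin//; last 2 first.
  - exact: measurable_funTS mw.
  - by rewrite divr_ge0// ltW.
  rewrite (EFinM (C / X) W); apply: lee_wpmul2l; first by rewrite lee_fin divr_ge0// ltW.
  by rewrite -WE; apply: ge0_subset_integral.
have Ble x : (x = 1 \/ x = -1) ->
    (\int[S]_(u in ~` N) ((C * X ^+ 26)%:E * (\1_(strip x del tau) u)%:E)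
    <= (C * c / X)%:E)%E.
  move=> hx; rewrite ge0_integralZl_EFin//; last 2 first.
  - by apply/measurable_EFinP.
  - by rewrite mulr_ge0// exprn_ge0// ltW.
  rewrite integral_indic//.
  apply: (@le_trans _ _ ((C * X ^+ 26)%:E * (c * tau ^+ 3)%:E)%E).
    by apply: lee_wpmul2l; [rewrite lee_fin mulr_ge0// exprn_ge0// ltW|exact: S_strip].
  rewrite -EFinM lee_fin le_eqVlt; apply/orP; left; apply/eqP.
  by rewrite /tau; field; rewrite gt_eqF.
apply: (@le_trans _ _ (A + ((\int[S]_(u in ~` N) ((C * X ^+ 26)%:E * (\1_(strip 1 del tau) u)%:E)) +
   \int[S]_(u in ~` N) ((C * X ^+ 26)%:E * (\1_(strip (-1) del tau) u)%:E))))%E.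
  have mi x : measurable_fun (~` N) (fun u => (C * X ^+ 26)%:E * (\1_(strip x del tau) u)%:E)%E.
    by apply: emeasurable_funM => //; apply/measurable_EFinP.
  have mwN : measurable_fun (~` N) (fun u => (C / X)%:E * (weight u)%:E)%E.
    by apply: emeasurable_funM => //; exact: measurable_funTS mw.
  have CX : 0 <= C * X ^+ 26 by rewrite mulr_ge0// exprn_ge0// ltW.
  have i0 x u : (0 <= (C * X ^+ 26)%:E * (\1_(strip x del tau) u)%:E)%E.
    by rewrite -EFinM lee_fin mulr_ge0//; have /andP[] := indic01 (strip x del tau) u.
  have j0 u : (0 <= (C / X)%:E * (weight u)%:E)%E.
    by apply: mule_ge0 => //; rewrite lee_fin divr_ge0// ltW.
  rewrite -ge0_integralD// -ge0_integralD//; last 2 first.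
  - by move=> u _; exact: adde_ge0.
  - exact: emeasurable_funD.
  apply: ge0_le_integral => //.
  - by move=> u _; rewrite lee_fin power_ge0.
  - by apply/measurable_EFinP; exact: measurable_funTS mp.
  - by apply: emeasurable_funD => //; exact: emeasurable_funD.
  - move=> u _; apply: le_trans (_ : ((C / X * weight u +
      C * X ^+ 26 * (\1_(strip 1 del tau) u + \1_(strip (-1) del tau) u))%:E <= _)%E).
      by rewrite lee_fin.
    by rewrite mulrDr !EFinD !EFinM.
apply: (@le_trans _ _ ((C / X * W)%:E + ((C * c / X)%:E + (C * c / X)%:E))%E).
  by apply: leeD => //; apply: leeD; apply: Ble; [left|right].
rewrite -!EFinD lee_fin.
have -> : C / X * W + (C * c / X + C * c / X) = z / X by rewrite /z; field; rewrite gt_eqF.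
rewrite ler_pdivrMr// -ler_pdivrMl// mulrC; exact: le_trans tz tX.
Qed.

(** The bump minus its multiplied version has power [mu ^+ 2 * power g0], with
    [mu] bounded by 2. Off [N] the bump itself has little power; on [N] and in the
    cell [mu] is small in mean; outside the cell the weight has little mass. The
    correction then restores the value 1 on the square. *)
Lemma small_extension r (e : R) : 0 < r -> 0 < e -> exists rho g,
  [/\ tame rho g, forall x, square r x -> g x = 1 &
    (\int[S]_(u in [set: borel2 R]) (power g u)%:E < e%:E)%E].
Proof.
move=> r0 e0.
pose eta := e / (8 * (W + 1)).
have eta0 : 0 < eta by rewrite divr_gt0// mulr_gt0// ltr_wpDl.
have [n hn] := correction_small r0 eta0.
have [m hm] := bump_off_null (ltn0Sn n).
have [t0 ht0] := hn m.
have e640 : 0 < e / 64 by rewrite divr_gt0.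
have [t1 ht1] := hm _ e640.
pose t := 1 + r + `|t0| + `|t1|.
have := normr_ge0 t0; have := normr_ge0 t1; have := ler_norm t0; have := ler_norm t1.
move=> n1 n2 n3 n4.
have tt0 : t0 <= t by rewrite /t; lra.
have tt1 : t1 <= t by rewrite /t; lra.
have t1' : 1 <= t by rewrite /t; lra.
have rt : r <= t by rewrite /t; lra.
have [off [K [K0 hK]]] := ht1 t tt1 t1'.
set T := (t ^+ n.+1) ^+ 12.
have tT : t <= T.
  by rewrite /T -exprM -{1}[t]expr1; apply: ler_weXn2l => //; rewrite muln_gt0.
have [tcor pcor] := ht0 t T tt0 tT.
set g0 := bump n.+1 m t T in off hK *.
have tg0 : tame T g0 by apply: tame_bump => //; lra.
have K1 : 0 < K + 1 by lra.
have e2 : 0 < e / (64 * (K + 1)) by rewrite divr_gt0// mulr_gt0.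
have e3 : 0 < e / (32 * (K + 1)) by rewrite divr_gt0// mulr_gt0.
have [om om0 tail] := weight_tail e2.
have Tr0 : 0 <= (T + r) / om by rewrite divr_ge0 ?(ltW om0)//; lra.
pose k := Num.bound ((T + r) / om).
have kb : T + r < om * k%:R by rewrite mulrC -ltr_pdivrMr//; exact: archi_boundP.
have [h [th mu2 mue]] := singular_multiplier om0 (cell_finite om0) mN N0 Nsym k e3.
have far z : z \notin grid k ->
    T + r < `|(freq om z).1| \/ T + r < `|(freq om z).2|.
  have big (i : int) : ~~ (`|i| <= k)%N -> T + r < `|om * i%:~R|.
    rewrite -ltnNge => ki; apply: lt_le_trans kb _.
    rewrite normrM (gtr0_norm om0) ler_pM2l// -intr_norm -[k%:R]/(k%:~R) ler_int.
    by rewrite -abszE lez_nat ltnW.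
  by rewrite mem_grid negb_and => /orP[/big|/big] ?; [left|right].
have [r1 [f [tf fr pf]]] := multiplier tg0 far th.
pose mu u := 1 - 2^-1 * (h u + h (- u)).
pose rho := Num.max T (Num.max r1 r).
have tg0' : tame rho g0 by apply: tame_widen tg0; rewrite le_max lexx.
have tf' : tame rho f by apply: tame_widen tf; rewrite !le_max lexx orbT.
have tcor' : tame rho (correction r n.+1 m t T).
  by apply: tame_widen tcor; rewrite !le_max lexx !orbT.
pose g1 x := 1 * g0 x + (-1) * f x.
have tg1 : tame rho g1 by exact: tame_lin.
have pg1 u : power g1 u = mu u ^+ 2 * power g0 u.
  rewrite /power !(phase_int_lin _ _ _ _ tg0' tf') !pf /mu; ring.
exists rho, (fun x => g1 x + correction r n.+1 m t T x); split.
- have := tame_lin 1 1 tg1 tcor'; congr (tame _ _).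
  by apply/funext => x; rewrite !mul1r.
- move=> x xr; rewrite /g1 fr// mulr0 addr0 mul1r; exact: correctionE.
have mmu : measurable_fun [set: borel2 R] mu.
  apply: measurable_funB => //; apply: measurable_funM => //.
  apply: measurable_funD; first exact: measurable_trig th.
  exact: (measurableT_comp (measurable_trig th) (@measurable_opp2 R)).
have mp0 : measurable_fun [set: borel2 R] (power g0) := measurable_power tg0.
pose F u := mu u ^+ 2 * power g0 u.
have F0 u : 0 <= F u by rewrite mulr_ge0 ?sqr_ge0 ?power_ge0.
have mF : measurable_fun [set: borel2 R] F by apply: measurable_funM => //; exact: measurable_funX.
have mc := measurable_cell om.
have mu4 u : mu u ^+ 2 <= 4.
  rewrite -(real_normK (num_real _)); apply: (@le_trans _ _ (2 ^+ 2)); last by rewrite expr2; lra.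
  by rewrite lerXn2r ?nnegrE//; exact: mu2.
have wu u : 0 <= weight u := ltW (weight_gt0 u).
have I1 : (\int[S]_(u in ~` N) (F u)%:E <= (4 * (e / 64))%:E)%E.
  apply: (@le_trans _ _ (\int[S]_(u in ~` N) (4%:E * (power g0 u)%:E))%E).
    apply: (@le_integral_EFin _ _ _ S _ F (fun u => 4 * power g0 u)) => //.
    - exact: measurableC.
    - exact: measurable_funTS.
    - by apply: measurable_funTS; exact: measurable_funM.
    - by move=> u _; rewrite ler_wpM2r ?power_ge0.
  rewrite ge0_integralZl_EFin//; last 3 first.
  - exact: measurableC.
  - by move=> u _; rewrite lee_fin power_ge0.
  - by apply/measurable_EFinP; exact: measurable_funTS.
  by rewrite (EFinM 4); exact: lee_wpmul2l.
have I2 : (\int[S]_(u in cell om `&` N) (F u)%:E <= (2 * K * (e / (32 * (K + 1))))%:E)%E.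
  apply: (@le_trans _ _ (\int[S]_(u in cell om `&` N) ((2 * K)%:E * `|mu u|%:E))%E).
    apply: (@le_integral_EFin _ _ _ S _ F (fun u => 2 * K * `|mu u|)) => //.
    - exact: measurableI.
    - exact: measurable_funTS.
    - by apply: measurable_funTS; apply: measurable_funM => //; exact: measurableT_comp.
    - move=> u _; rewrite /F -(real_normK (num_real _)) expr2.
      have pK : power g0 u <= K.
        by apply: le_trans (hK u) _; rewrite -[leRHS]mulr1 ler_wpM2l ?weight_le1.
      have -> : 2 * K * `|mu u| = (2 * `|mu u|) * K by ring.
      apply: ler_pM => //; rewrite ?mulr_ge0 ?power_ge0//.
      by rewrite ler_wpM2r//; exact: mu2.
  rewrite ge0_integralZl_EFin//; last 3 first.
  - exact: measurableI.
  - by apply/measurable_EFinP; apply: measurable_funTS; exact: measurableT_comp.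
  - by rewrite mulr_ge0.
  by rewrite (EFinM (2 * K)); apply: lee_wpmul2l; [rewrite lee_fin mulr_ge0|exact: ltW].
have I3 : (\int[S]_(u in ~` cell om `&` N) (F u)%:E <= (4 * K * (e / (64 * (K + 1))))%:E)%E.
  apply: (@le_trans _ _ (\int[S]_(u in ~` cell om) ((4 * K)%:E * (weight u)%:E))%E).
    apply: (@le_trans _ _ (\int[S]_(u in ~` cell om) (F u)%:E)%E).
      apply: ge0_subset_integral => //.
      + by apply: measurableI => //; exact: measurableC.
      + exact: measurableC.
      + by apply/measurable_EFinP; exact: measurable_funTS.
      + by move=> u _; rewrite lee_fin.
    apply: (@le_integral_EFin _ _ _ S _ F (fun u => 4 * K * weight u)) => //.
    - exact: measurableC.
    - exact: measurable_funTS.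
    - by apply: measurable_funTS; apply: measurable_funM => //; exact: measurable_weight.
    - move=> u _; rewrite -mulrA; apply: ler_pM; rewrite ?sqr_ge0 ?power_ge0//.
  rewrite ge0_integralZl_EFin//; last 3 first.
  - exact: measurableC.
  - exact: measurable_funTS mw.
  - by rewrite mulr_ge0.
  by rewrite (EFinM (4 * K)); apply: lee_wpmul2l; [rewrite lee_fin mulr_ge0|exact: ltW].
have mFE D : measurable_fun D (fun u => (F u)%:E).
  by apply/measurable_EFinP; exact: measurable_funTS.
have IF : (\int[S]_(u in [set: borel2 R]) (F u)%:E <= (e / 4)%:E)%E.
  have -> : [set: borel2 R] = ~` N `|` ((cell om `&` N) `|` (~` cell om `&` N)).
    by rewrite -setIUl setUv setTI setUC setUv.
  have mcN : measurable (cell om `&` N) by exact: measurableI.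
  have mcN' : measurable (~` cell om `&` N) by apply: measurableI => //; exact: measurableC.
  have mNc : measurable (~` N) by exact: measurableC.
  have mU : measurable ((cell om `&` N) `|` (~` cell om `&` N)) by exact: measurableU.
  rewrite ge0_integral_setU//; last 3 first.
  - exact: mFE.
  - by move=> u _; rewrite lee_fin.
  - by apply/disj_setPS => u [/= nN] [[_ Nu]|[_ Nu]].
  rewrite ge0_integral_setU//; last 3 first.
  - exact: mFE.
  - by move=> u _; rewrite lee_fin.
  - by apply/disj_setPS => u [[/= cu _] [ncu _]].
  apply: le_trans (leeD I1 (leeD I2 I3)) _; rewrite -!EFinD lee_fin.
  have KK : K / (K + 1) <= 1 by rewrite ler_pdivrMr// mul1r lerDl.
  have -> : 4 * (e / 64) + (2 * K * (e / (32 * (K + 1))) + 4 * K * (e / (64 * (K + 1)))) =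
      e / 16 + e / 8 * (K / (K + 1)) by field; rewrite gt_eqF.
  have : e / 8 * (K / (K + 1)) <= e / 8 * 1 by rewrite ler_wpM2l// divr_ge0// ltW.
  by lra.
have F0E u : (0 <= (F u)%:E)%E by rewrite lee_fin.
have I0 : (0 <= \int[S]_u (F u)%:E)%E by apply: integral_ge0.
apply: (@le_lt_trans _ _ (2%:E * \int[S]_u (F u)%:E + (2 * eta)%:E * W%:E)%E).
  have m2F : measurable_fun [set: borel2 R] (fun u => 2%:E * (F u)%:E)%E.
    by apply: emeasurable_funM => //; exact: mFE.
  have m2w : measurable_fun [set: borel2 R] (fun u => (2 * eta)%:E * (weight u)%:E)%E.
    exact: emeasurable_funM.
  rewrite -WE -ge0_integralZl_EFin//; last exact: mFE.
  rewrite -ge0_integralZl_EFin//; last by rewrite mulr_ge0// ltW.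
  rewrite -ge0_integralD//; last 2 first.
  - by move=> u _; apply: mule_ge0.
  - by move=> u _; apply: mule_ge0 => //; rewrite lee_fin mulr_ge0// ltW.
  apply: ge0_le_integral => //.
  - by move=> u _; rewrite lee_fin power_ge0.
  - apply/measurable_EFinP; apply: (@measurable_power _ rho).
    have := tame_lin 1 1 tg1 tcor'; congr (tame _ _).
    by apply/funext => x; rewrite !mul1r.
  - exact: emeasurable_funD.
  - move=> u _; rewrite -!EFinM -EFinD lee_fin.
    apply: le_trans (powerD_le u tg1 tcor') _; rewrite pg1 mulrDr lerD2l -mulrA.
    by rewrite ler_wpM2l//; exact: pcor.
have IFe : (2%:E * \int[S]_u (F u)%:E <= (e / 2)%:E)%E.
  have -> : e / 2 = 2 * (e / 4) by field.
  by rewrite (EFinM 2); exact: lee_wpmul2l.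
apply: le_lt_trans (leeD2r _ IFe) _.
rewrite -EFinM -EFinD lte_fin.
have WW : W / (W + 1) <= 1 by rewrite ler_pdivrMr ?ltr_wpDl// mul1r lerDl.
have -> : 2 * eta * W = e / 4 * (W / (W + 1)).
  by rewrite /eta; field; rewrite gt_eqF// ltr_wpDl.
have : e / 4 * (W / (W + 1)) <= e / 4 * 1 by rewrite ler_wpM2l// divr_ge0// ltW.
by lra.
Qed.

End Extension.

(** * Rigidity *)

Section Sets.
Variable R : realType.
Implicit Types (u x : R * R).

Lemma ball_square (x y : R * R) (e : R) : ball x e y <->
  `|x.1 - y.1| < e /\ `|x.2 - y.2| < e.
Proof. by split=> -[]. Qed.

(** Every point of an open set lies in a box with rational centre, and radius the
    inverse of an integer, contained in the open set. *)
Lemma measurable_open2 (U : set (R * R)) : open U -> measurable (U : set (borel2 R)).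
Proof.
move=> oU.
pose bx (q : rat * rat * nat) : set (borel2 R) :=
  `]ratr q.1.1 - q.2.+1%:R^-1, ratr q.1.1 + q.2.+1%:R^-1[%classic `*`
  `]ratr q.1.2 - q.2.+1%:R^-1, ratr q.1.2 + q.2.+1%:R^-1[%classic.
have -> : U = \bigcup_q (if `[< bx q `<=` U >] then bx q else set0).
  apply/seteqP; split=> [[a b] Uab|x [q _]]; last by case: asboolP => // qU /qU.
  have /nbhs_ballP[e /= e0 eU] : nbhs (a, b) U by exact: open_nbhs_nbhs.
  have [n ne] : exists n, n.+1%:R^-1 < e / 2.
    exists (Num.bound (2 / e)).
    rewrite invf_plt ?posrE ?divr_gt0// invfM invrK.
    have h : 0 <= 2 / e by rewrite divr_ge0// ltW.
    rewrite mulrC; apply: lt_le_trans (archi_boundP h) _.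
    by rewrite ler_nat.
  have n0 : 0 < n.+1%:R^-1 :> R by rewrite invr_gt0.
  have near_rat (c : R) : exists q : rat, `|c - ratr q| < n.+1%:R^-1.
    have cc : c - n.+1%:R^-1 < c + n.+1%:R^-1.
      by rewrite ltrBlDr -addrA ltrDl addr_gt0.
    have [q] := rat_in_itvoo cc; rewrite in_itv/= -ltr_distl distrC => qc; by exists q.

  have [q1 h1] := near_rat a; have [q2 h2] := near_rat b.
  exists (q1, q2, n) => //; case: asboolP => [_|[]].
    by split; rewrite /= in_itv/= -ltr_distl.
  move=> [c d] [] /=; rewrite !in_itv/= -!ltr_distl => h3 h4.
  apply: eU; apply/ball_square => /=.
  have tri (x y q : R) : `|x - q| < n.+1%:R^-1 -> `|y - q| < n.+1%:R^-1 -> `|x - y| < e.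
    move=> xq yq; rewrite [e]splitr -(subrKA q); apply: le_lt_trans (ler_normD _ _) _.
    by rewrite (distrC q) ltrD// (lt_trans _ ne).
  by split; [exact: tri h1 h3|exact: tri h2 h4].
apply: countable_bigcupT_measurable; first exact: countableP.
by move=> q; case: asboolP => // _; exact: measurableX.
Qed.

Lemma measurable_compact2 (A : set (R * R)) : compact A -> measurable (A : set (borel2 R)).
Proof.
move=> cA; have clA : closed A by apply: compact_closed => //; exact: norm_hausdorff.
by rewrite -[A]setCK; apply: measurableC; apply: measurable_open2; exact: closed_openC.
Qed.

Lemma compact_square (A : set (R * R)) : compact A ->
  exists2 r, 0 < r & forall x, A x -> square r x.
Proof.
move=> cA.
have bnd (X : R * R -> R) : continuous X -> exists K : R, 0 < K /\ forall x, A x -> `|X x| <= K.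
  move=> cX; have := @compact_bounded R R^o (X @` A).
  case; first by apply: continuous_compact => //; exact: continuous_subspaceT.
  move=> K [_ /(_ (`|K| + 1)) h]; exists (`|K| + 1); split; first by rewrite ltr_wpDl.
  move=> x Ax; apply: h; last by exists x.
  by rewrite (le_lt_trans (ler_norm _))// ltrDl.
have [K [K0 hK]] := bnd fst (fun x => cvg_fst).
have [L [L0 hL]] := bnd snd (fun x => cvg_snd).
exists (K + L); first exact: addr_gt0.
by move=> x Ax; split; [apply: le_trans (hK x Ax) _; rewrite lerDl ltW
  |apply: le_trans (hL x Ax) _; rewrite lerDr ltW].
Qed.

Lemma tame_indic (A : set (borel2 R)) r : measurable A ->
  (forall x, A x -> square r x) -> tame r (\1_A : R * R -> R).
Proof.
move=> mA Ar; split; first exact: measurable_indic.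
- exists 1 => x; have /andP[h0 h1] := indic01 A x; by rewrite ger0_norm.
- by move=> x nx; rewrite indicE memNset// => /Ar.
Qed.

End Sets.

Lemma variance_ae (d : measure_display) (T : measurableType d) (R : realType)
    (P : probability T R) (X Y : T -> R) :
  measurable_fun [set: T] X -> measurable_fun [set: T] Y ->
  {ae P, forall t, X t = Y t} -> 'V_P[X] = 'V_P[Y].
Proof.
move=> mX mY XY.
have eE (f g : T -> R) : measurable_fun [set: T] f -> measurable_fun [set: T] g ->
    {ae P, forall t, f t = g t} -> ('E_P[f] = 'E_P[g])%E.
  move=> mf mg fg; rewrite unlock; apply: ae_eq_integral => //; try exact/measurable_EFinP.
  by apply: filterS fg => t /= -> _.
rewrite /variance unlock (eE X Y)//; apply: eE.
- by apply: measurable_funM; apply: measurable_funB.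
- by apply: measurable_funM; apply: measurable_funB.
- by apply: filterS XY => t XYt; rewrite /GRing.mul /= XYt.
Qed.

(** The set carrying the singular part is made symmetric, so that the spectral
    symmetry turns the bound near one critical point into a bound near the other. *)
Lemma singular_carrier (R : realType) (S : {measure set (borel2 R) -> \bar R})
  (s : R * R -> R) (c : R) :
  (forall B : set (borel2 R), measurable B -> S [set u : R * R | B (- u)] = S B) ->
  spectral_density S s ->
  (\forall u \near ((1, 0) : R * R), s u <= c * u.2 ^+ 2) ->
  exists (N : set (borel2 R)) (del k : R),
    [/\ measurable N, lebesgue2 R N = 0%E, forall u, N u -> N (- u),
        0 < del <= 1 /\ 0 <= k &
      forall x tau, (x = 1 \/ x = -1) -> 0 <= tau -> tau < del ->
        (S (strip x del tau `&` ~` N) <= (k * tau ^+ 3)%:E)%E].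
Proof.
move=> symS [ms s0 [Ssing [[N1 [mN1 SN1 LN1]] SE]]] hc.
have /nbhs_ballP[e /= e0 he] := hc.
pose opp := @plane_iso R true 0.
have oppE u : opp u = - u.
  by rewrite /opp /plane_iso /line_iso expr1; case: u => a b /=; rewrite !mulN1r !addr0.
pose N := ~` N1 `|` opp @^-1` (~` N1).
have mN1c : measurable (~` N1) by exact: measurableC.
have mopp : measurable (opp @^-1` (~` N1)).
  by rewrite -[X in measurable X]setTI; exact: measurable_plane_iso.
have mN : measurable N by exact: measurableU.
have LN : lebesgue2 R N = 0%E.
  apply/eqP; rewrite -measure_le0; apply: le_trans (measureU2 _ _ _) _ => //.
  by rewrite [X in (X + _)%E]LN1 [X in (_ + X)%E]lebesgue2_iso// [X in (_ + X)%E]LN1 adde0.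
have Nsym u : N u -> N (- u).
  by move=> [h|h]; [right; rewrite /= oppE opprK|left; move: h; rewrite /= oppE].
pose del := Num.min 1 e.
have del0 : 0 < del by rewrite lt_min ltr01.
have de : del <= e by rewrite ge_min lexx orbT.
pose k := Num.max c 0 * (4 * del).
have k0 : 0 <= Num.max c 0 by rewrite le_max lexx orbT.
have key tau : 0 <= tau -> tau < del ->
    (S (strip 1 del tau `&` ~` N) <= (k * tau ^+ 3)%:E)%E.
  move=> tau0 taud.
  have mB : measurable (strip 1 del tau `&` ~` N).
    by apply: measurableI; [exact: measurable_strip|exact: measurableC].
  rewrite SE//.
  have -> : Ssing (strip 1 del tau `&` ~` N) = 0%E.
    apply: (@subset_measure0 _ _ _ Ssing _ N1) => //.
    by move=> u [_ nN]; apply: contrapT => nN1; apply: nN; left.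
  rewrite adde0.
  apply: (@le_trans _ _ (\int[lebesgue2 R]_(u in strip 1 del tau `&` ~` N)
      (Num.max c 0 * tau ^+ 2)%:E)%E).
    apply: (@le_integral_EFin _ _ _ (lebesgue2 R) _ s (fun=> Num.max c 0 * tau ^+ 2)) => //.
    - exact: measurable_funTS.
    - move=> u [[u1 u2] _].
      have : s u <= c * u.2 ^+ 2.
        apply: he; apply/ball_square => /=; rewrite distrC sub0r normrN; split; lra.
      move=> /le_trans; apply; apply: (@le_trans _ _ (Num.max c 0 * u.2 ^+ 2)).
        by rewrite ler_wpM2r ?sqr_ge0// le_max lexx.
      rewrite ler_wpM2l// -(real_normK (num_real u.2)) lerXn2r ?nnegrE//.
  rewrite integral_cst//.
  apply: (@le_trans _ _ ((Num.max c 0 * tau ^+ 2)%:E * lebesgue2 R (strip 1 del tau))%E).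
    apply: lee_wpmul2l; first by rewrite lee_fin mulr_ge0// sqr_ge0.
    apply: le_measure; rewrite ?inE//; first exact: measurable_strip.
  rewrite lebesgue2_strip// -EFinM lee_fin /k le_eqVlt; apply/orP; left; apply/eqP; ring.
exists N, del, k; split=> //.
  by rewrite del0 ge_min lexx mulr_ge0// mulr_ge0// ltW.
move=> x tau [->|->] tau0 taud; first exact: key.
rewrite -(symS (strip (-1) del tau `&` ~` N)); last first.
  by apply: measurableI; [exact: measurable_strip|exact: measurableC].
apply: le_trans (key tau tau0 taud); rewrite le_eqVlt; apply/orP; left; apply/eqP.
have dN (a : R) : `|- a - -1| = `|a - 1| by rewrite -normrN; congr (`|_|); ring.
congr (S _); apply/seteqP; split=> -[a b] [[h1 h2] h3].
  split; last by move=> /Nsym.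
  by split; [rewrite -dN|rewrite -normrN].
split; last by move=> /Nsym; rewrite opprK.
by split; [rewrite /= dN|rewrite /= normrN].
Qed.

Theorem proposition3 (d : measure_display) (T : measurableType d)
  (R : realType) (P : probability T R) (M : (R * R -> R) -> T -> R)
  (S : {measure set (borel2 R) -> \bar R}) (s : R * R -> R) (c : R)
  (hM : WSS_random_measure P M S)
  (hs : spectral_density S s)
  (hc : \forall u \near ((1, 0) : R * R), s u <= c * u.2 ^+ 2)
  (A : set (R * R)) (hA : convex_body A) :
  linearly_0_rigid P M A.
Proof.
have cA := convex_body_compact hA.
have mA := measurable_compact2 cA.
have [r r0 Ar] := compact_square cA.
have [N [del [k [mN N0 Nsym [/andP[del0 del1] k0] strips]]]] :=
  singular_carrier (WSS_symmetric hM) hs hc.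
have wfin := weight_integrable hM.
have tA := tame_indic mA Ar.
have mP := random_measure_L2 (WSS_L2 hM).
have pi20 : 0 < (2 * pi) ^- 2 :> R by rewrite invr_gt0 exprn_gt0// mulr_gt0// pi_gt0.
apply/eqP; rewrite eq_le; apply/andP; split; last first.
  by apply: le_ereal_inf_tmp => _ [h _ <-]; exact: variance_ge0.
apply/lee_addgt0Pr => e e0; rewrite add0e.
have e1 : 0 < e * (2 * pi) ^+ 2 by rewrite mulr_gt0// exprn_gt0// mulr_gt0// pi_gt0.
have [rho [g [tg g1 pg]]] :=
  small_extension wfin mN N0 Nsym del0 del1 k0 strips r0 e1.
pose h x := 1 * (\1_A : R * R -> R) x + (-1) * g x.
have th : tame (Num.max r rho) h.
  apply: tame_lin; first by apply: tame_widen tA; rewrite le_max lexx.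
  by apply: tame_widen tg; rewrite le_max lexx orbT.
have [Ch CA Cg] := And3 (tame_Ccb th) (tame_Ccb tA) (tame_Ccb tg).
apply: (@le_trans _ _ 'V_P[M (\1_A) \- M h]).
  apply: ereal_inf_lbound; exists h => //; split=> // x Ax.
  by rewrite /h indicE mem_set// g1 ?mul1r ?mulN1r ?subrr//; exact: Ar.
have mM f : Ccb f -> measurable_fun [set: T] (M f).
  by move=> /mP; rewrite inE => /andP[+ _]; rewrite inE.
have -> : 'V_P[M (\1_A) \- M h] = 'V_P[M g].
  apply: variance_ae; [by apply: measurable_funB; exact: mM|exact: mM|].
  have := random_measure_linear (WSS_L2 hM) 1 (-1) CA Ch.
  apply: filterS => t /=.
  have -> : (fun x => 1 * (\1_A : R * R -> R) x + -1 * h x) = g.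
    by apply/funext => x; rewrite /h; ring.
  by move=> ->; rewrite mul1r mulN1r.
rewrite (WSS_spectral hM Cg).
under eq_integral do rewrite normc_fourier2.
apply: (@le_trans _ _ (((2 * pi) ^- 2)%:E * (e * (2 * pi) ^+ 2)%:E)%E).
  by apply: lee_wpmul2l; [rewrite lee_fin ltW|exact: ltW].
rewrite -EFinM lee_fin le_eqVlt; apply/orP; left; apply/eqP.
by rewrite mulrC mulfK// expf_neq0// mulf_neq0// gt_eqF// pi_gt0.
Qed.
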